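(* Let $(M,g,X)$ be an asymptotically conical gradient Kähler–Ricci expander with Kähler cone $(\mathcal C,g_{\mathcal C})$. For every $\delta>0$, $(\varrho(\mathcal B(g_{\mathcal C},\delta)),\operatorname{BL}_\infty)$ is a metric space. Moreover, the map $$\varrho:(\mathcal B(g_{\mathcal C},\delta),\operatorname{BL}_{\mathcal C})\to(\varrho(\mathcal B(g_{\mathcal C},\delta)),\operatorname{BL}_\infty)$$ is an isometry.
   Context: Conventions: a Kähler–Ricci expander is a triple $(M,g,X)$ with $M$ a complex manifold, $g$ Kähler, $X$ a real holomorphic vector field and $\frac12\mathcal L_Xg=\operatorname{Ric}(g)+g$; it is gradient if $X=\nabla^g f$. It is asymptotically conical (AC) if it is a complete gradient expander and $\sup_{x\in M}|(\nabla^g)^k\operatorname{Rm}(g)|_g(x)\,d_g(p,x)^{2+k}<\infty$ for all integers $k\ge0$ ($p$ a fixed point). $\Phi_t$ ($t>0$) is the flow of $-\frac{X}{2t}$ with $\Phi_1=\mathrm{id}$; the self-similar solution of $(M,g,X)$ is $g(t)=t\Phi_t^*g$, $t>0$. A Kähler cone is a Riemannian cone $(\mathcal C,g_{\mathcal C})$, $\mathcal C\setminus\{o\}=\mathbb R_{>0}\times S$ with $S$ closed, $g_{\mathcal C}=dr^2+r^2g_S$, apex $o$, Kähler with respect to a parallel complex structure $J_{\mathcal C}$; its Reeb field is $\xi=J_{\mathcal C}r\partial_r$. A Kähler conical metric on $\mathcal C$ is a Kähler metric on $\mathcal C\setminus\{o\}$ making $\mathcal C$ a Kähler cone. Known structure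 theorem (Conlon–Deruelle–Sun), fixing notation: for an AC gradient expander there is a Kähler resolution $\pi:M\to\mathcal C$ of a Kähler cone $(\mathcal C,g_{\mathcal C})$ with exceptional set $E$ (so $\pi:M\setminus E\to\mathcal C\setminus\{o\}$ is a biholomorphism), with $d\pi(X)=r\partial_r$ and $|(\nabla^{g_{\mathcal C}})^k(\pi_*g-g_{\mathcal C})|_{g_{\mathcal C}}\le C_kr^{-2-k}$ near infinity for all $k\ge0$. For metrics $g_1,g_2$ on $\mathcal C\setminus\{o\}$, $\operatorname{BL}_{\mathcal C}(g_1,g_2)=\sup_{x\in\mathcal C\setminus\{o\}}\inf\{\delta\ge 0: e^{-\delta}g_2(x)\le g_1(x)\le e^{\delta}g_2(x)\}$ (also denoted $\operatorname{BL}$). $\mathcal B(g_{\mathcal C},\delta)$ is the set of $\xi$-invariant Kähler conical metrics $g'_{\mathcal C}$ on $\mathcal C$ with $\operatorname{BL}_{\mathcal C}(g_{\mathcal C},g'_{\mathcal C})\le\delta$, with the metric $\operatorname{BL}_{\mathcal C}$. For each $g'_{\mathcal C}\in\mathcal B(g_{\mathcal C},\delta)$ there is (known) a unique gradient Kähler–Ricci expander $(M,g',X)$ with bounded curvature such that its self-similar solution satisfies $\pi_*g'(t)\to g'_{\mathcal C}$ locally smoothly on $\mathcal C\setminus\{o\}$ as $t\to0^+$; put $\varrho(g'_{\mathcal C})=(M,g',X)$, identified with $g'$. For metrics $g_1,g_2$ on $M$: $\operatorname{BL}_x(g_1,g_2)=\inf\{\sigma\ge0: e^{-\sigma}g_2(x)\le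 g_1(x)\le e^\sigma g_2(x)\}$ and $\operatorname{BL}_\infty(g_1,g_2)=\limsup_{d_g(p,x)\to\infty}\operatorname{BL}_x(g_1,g_2)$, a pseudometric. *)

(* Defs.v *)
From HB Require Import structures.
From mathcomp Require Import all_boot all_order all_algebra.
From mathcomp Require Import all_classical all_reals all_analysis.
Set Implicit Arguments. Unset Strict Implicit. Unset Printing Implicit Defensive.
Import Order.TTheory GRing.Theory Num.Theory numFieldNormedType.Exports.
Local Open Scope classical_set_scope.
Local Open Scope ring_scope.

(* Tangent vectors are row vectors: a differential acts by v |-> v *m 'J F x,
   and a bilinear form h is (v, w) |-> v *m h *m w^T. *)

Section Calculus.
Context {R : realType}.

Definition partial {m} (i : 'I_m) (f : 'rV[R]_m -> R) (u : 'rV[R]_m) : R :=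
  'D_(delta_mx 0 i) f u.

Definition partials {m} (s : seq 'I_m) (f : 'rV[R]_m -> R) : 'rV[R]_m -> R :=
  foldr partial f s.

(* C^oo on the open set U *)
Definition smooth_on {m} (U : set 'rV[R]_m) (f : 'rV[R]_m -> R) :=
  forall (s : seq 'I_m) u, U u -> differentiable (partials s f) u.

Definition smooth_map_on {m p} (U : set 'rV[R]_m) (F : 'rV[R]_m -> 'rV[R]_p) :=
  forall j, smooth_on U (fun u => F u 0 j).

(* the complex structure (x, y) |-> (-y, x) of C^n = R^n + R^n *)
Definition J0 {n} : 'M[R]_(n + n) := block_mx 0 1%:M (- 1%:M) 0.

Definition holo_on {n p} (U : set 'rV[R]_(n + n))
    (F : 'rV[R]_(n + n) -> 'rV[R]_(p + p)) :=
  smooth_map_on U F /\ forall u, U u -> J0 *m jacobian F u = jacobian F u *m J0.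

End Calculus.

Section LocalGeometry.
Context {R : realType} {m : nat}.
Implicit Types (G H : 'rV[R]_m -> 'M[R]_m) (V : 'rV[R]_m -> 'rV[R]_m).

(* christoffel G u k i j is Gamma^j_{ki} *)
Definition christoffel G (u : 'rV[R]_m) (k : 'I_m) : 'M[R]_m :=
  \matrix_(i, j) (2^-1 * \sum_l invmx (G u) j l *
    (partial k (fun v => G v i l) u + partial i (fun v => G v k l) u
     - partial l (fun v => G v k i) u)).

(* R(d_i, d_j) d_k = \sum_l riemann G u i j k l d_l, where
   R(X, Y) = [nabla_X, nabla_Y] - nabla_[X, Y] *)
Definition riemann G (u : 'rV[R]_m) (i j k l : 'I_m) : R :=
  partial i (fun v => christoffel G v j k l) u
  - partial j (fun v => christoffel G v i k l) u
  + \sum_p (christoffel G u i p l * christoffel G u j k p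
            - christoffel G u j p l * christoffel G u i k p).

Definition ricci_loc G (u : 'rV[R]_m) : 'M[R]_m :=
  \matrix_(j, k) \sum_i riemann G u i j k i.

Definition lie_loc V H (u : 'rV[R]_m) : 'M[R]_m :=
  \matrix_(i, j) \sum_k (V u 0 k * partial k (fun v => H v i j) u
    + partial i (fun v => V v 0 k) u * H u k j
    + partial j (fun v => V v 0 k) u * H u i k).

(* A covariant tensor of rank q is given by its components indexed by lists
   of length q; its values on lists of other lengths are irrelevant. *)
Definition ctensor := seq 'I_m -> 'rV[R]_m -> R.

Definition tensor2 H : ctensor :=
  fun s u => if s is [:: i; j] then H u i j else 0.

Definition riemann4 G : ctensor := fun s u =>
  if s is [:: i; j; k; l] then \sum_p riemann G u i j k p * G u p l else 0.

Definition covd G (T : ctensor) : ctensor := fun s u =>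
  if s is i :: s' then
    partial i (T s') u
    - \sum_(q < size s') \sum_l
        christoffel G u i (nth i s' q) l * T (set_nth i s' q l) u
  else 0.

Definition tensor_norm G q (T : ctensor) (u : 'rV[R]_m) : R :=
  Num.sqrt (\sum_(s : q.-tuple 'I_m) \sum_(t : q.-tuple 'I_m)
    (\prod_(a < q) invmx (G u) (tnth s a) (tnth t a)) * (T s u * T t u)).

End LocalGeometry.

Record chart (R : realType) (T : topologicalType) (m : nat) := Chart {
  dom : set T;
  coord :> T -> 'rV[R]_m;
  param : 'rV[R]_m -> T;
  dom_open : open dom;
  img_open : open (coord @` dom);
  coordK : forall x, dom x -> param (coord x) = x;
  coord_continuous : forall x, dom x -> {for x, continuous coord};
  param_continuous : forall u, (coord @` dom) u -> {for u, continuous param} }.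

Record manifold (R : realType) (m : nat) := Manifold {
  mspace :> topologicalType;
  mhausdorff : hausdorff_space mspace;
  msecond_countable : @second_countable mspace;
  atlas : set (chart R mspace m);
  chart_at : mspace -> chart R mspace m;
  chart_at_atlas : forall x, atlas (chart_at x);
  dom_chart_at : forall x, dom (chart_at x) x;
  transition_smooth : forall a b, atlas a -> atlas b ->
    smooth_map_on (a @` (dom a `&` dom b)) (b \o param a) }.
Arguments atlas {R m} _ _.

(* A complex manifold of complex dimension n. Its complex structure is the
   constant J0 in every chart of the atlas. *)
Record cmanifold (R : realType) (n : nat) := CManifold {
  underlying :> manifold R (n + n);
  transition_holo : forall a b, atlas underlying a -> atlas underlying b ->
    holo_on (a @` (dom a `&` dom b)) (b \o param a) }.

(* The tangent space at x is identified with R^m by means of chart_at x. Thus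
   a vector field is a map M -> 'rV_m, a 2-tensor field is a map M -> 'M_m, and
   components in another chart are obtained from the transition maps. *)
Section Tensors.
Context {R : realType} {m : nat} {M : manifold R m}.
Implicit Types (x : M) (a : chart R M m) (g h : M -> 'M[R]_m)
  (X : M -> 'rV[R]_m) (f : M -> R).

Definition frame a x : 'M[R]_m := jacobian (chart_at x \o param a) (a x).

Definition tcoord a h (u : 'rV[R]_m) : 'M[R]_m :=
  let x := param a u in frame a x *m h x *m (frame a x)^T.

Definition vcoord a X (u : 'rV[R]_m) : 'rV[R]_m :=
  let x := param a u in
  X x *m jacobian (a \o param (chart_at x)) (chart_at x x).

Definition smooth_fun f :=
  forall a, atlas M a -> smooth_on (a @` dom a) (f \o param a).

Definition smooth_tensor h :=
  forall a, atlas M a -> forall i j,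
    smooth_on (a @` dom a) (fun u => tcoord a h u i j).

Definition smooth_vfield X :=
  forall a, atlas M a -> smooth_map_on (a @` dom a) (vcoord a X).

Definition riemannian g :=
  [/\ smooth_tensor g, forall x, (g x)^T = g x &
      forall x (v : 'rV[R]_m), v != 0 -> 0 < (v *m g x *m v^T) 0 0].

Definition fdiff f x : 'rV[R]_m :=
  \row_i partial i (f \o param (chart_at x)) (chart_at x x).

Definition gradient g f x : 'rV[R]_m := fdiff f x *m invmx (g x).

Definition ricci g x : 'M[R]_m :=
  ricci_loc (tcoord (chart_at x) g) (chart_at x x).

Definition lie X h x : 'M[R]_m :=
  lie_loc (vcoord (chart_at x) X) (tcoord (chart_at x) h) (chart_at x x).

(* | nabla^k Rm(g) |_g (x) *)
Definition rm_norm g (k : nat) x : R :=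
  let G := tcoord (chart_at x) g in
  tensor_norm G (k + 4) (iter k (covd G) (riemann4 G)) (chart_at x x).

(* | (nabla^g)^k h |_g (x) *)
Definition nabla_norm g h (k : nat) x : R :=
  let G := tcoord (chart_at x) g in
  tensor_norm G (k + 2)
    (iter k (covd G) (tensor2 (tcoord (chart_at x) h))) (chart_at x x).

Definition bounded_curvature g := exists C, forall x, rm_norm g 0 x <= C.

(* piecewise C^1 paths, cut into pieces that lie in a single chart *)
Inductive path_length g : M -> M -> R -> Prop :=
| PathNil x : path_length g x x 0
| PathCons a (c : R -> 'rV[R]_m) y L :
    atlas M a ->
    (forall t, derivable c t 1) -> continuous (derive1 c) ->
    (forall t, t \in `[0, 1] -> (a @` dom a) (c t)) ->
    path_length g (param a (c 1)) y L ->
    path_length g (param a (c 0)) y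
      (\int[lebesgue_measure]_(t in `[0, 1]%classic)
         Num.sqrt ((derive1 c t *m tcoord a g (c t) *m (derive1 c t)^T) 0 0)
       + L).

Definition distance g x y : R := inf [set L | path_length g x y L].

Definition complete_metric g := forall u : nat -> M,
  (forall e, 0 < e -> exists K, forall i j,
     (K <= i)%N -> (K <= j)%N -> distance g (u i) (u j) < e) ->
  exists x, forall e, 0 < e -> exists K, forall i,
     (K <= i)%N -> distance g (u i) x < e.

(* Phi is the flow of the time-dependent field - X / (2 t), t > 0, with
   Phi_1 = id *)
Definition expander_flow X (Phi : R -> M -> M) :=
  (forall x, Phi 1 x = x) /\
  forall x t, 0 < t ->
    {for t, continuous (fun s => Phi s x)} /\
    is_derive t 1 (fun s => chart_at (Phi t x) (Phi s x))
      (- (2 * t)^-1 *: X (Phi t x)).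

(* h t --> h0 locally smoothly as t --> 0^+ *)
Definition locally_smooth_cvg (h : R -> M -> 'M[R]_m) (h0 : M -> 'M[R]_m) :=
  forall a (K : set 'rV[R]_m) (s : seq 'I_m) i j, atlas M a ->
    compact K -> K `<=` a @` dom a ->
    forall e, 0 < e -> \forall t \near 0^'+, forall u, K u ->
      `| partials s (fun v => tcoord a (h t) v i j) u
         - partials s (fun v => tcoord a h0 v i j) u | < e.

End Tensors.

Section Maps.
Context {R : realType} {m p : nat} {M : manifold R m} {N : manifold R p}.

Definition smooth_map (F : M -> N) := continuous F /\
  forall a b, atlas M a -> atlas N b ->
    smooth_map_on (a @` (dom a `&` F @^-1` dom b)) (b \o F \o param a).

Definition mdiff (F : M -> N) (x : M) : 'M[R]_(m, p) :=
  jacobian (chart_at (F x) \o F \o param (chart_at x)) (chart_at x x).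

Definition pullback (F : M -> N) (h : N -> 'M[R]_p) (x : M) : 'M[R]_m :=
  mdiff F x *m h (F x) *m (mdiff F x)^T.

End Maps.

Section Kaehler.
Context {R : realType} {n : nat} {M : cmanifold R n}.
Implicit Types (g : M -> 'M[R]_(n + n)) (X : M -> 'rV[R]_(n + n)) (p : M).

(* g is J-invariant and nabla^g J = 0; as J is constant in holomorphic charts,
   the latter says that J commutes with the connection matrices. *)
Definition kaehler g :=
  [/\ riemannian g, forall x, J0 *m g x *m J0^T = g x &
      forall x k, let Gamma :=
        christoffel (tcoord (chart_at x) g) (chart_at x x) k in
        J0 *m Gamma = Gamma *m J0].

(* X is smooth with L_X J = 0 *)
Definition real_holomorphic X :=
  forall a, atlas M a -> holo_on (a @` dom a) (vcoord a X).

Definition expander g X :=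
  [/\ kaehler g, real_holomorphic X &
      forall x, 2^-1 *: lie X g x = ricci g x + g x].

Definition gradient_expander g X :=
  expander g X /\ exists2 f : M -> R, smooth_fun f & X = gradient g f.

Definition ac_expander p g X :=
  [/\ gradient_expander g X, complete_metric g &
      forall k : nat, exists C, forall x,
        rm_norm g k x * distance g p x ^+ (2 + k) <= C].

Definition holo_fun_on (U : set M) (f : M -> 'rV[R]_(1 + 1)) :=
  forall a, atlas M a -> holo_on (a @` (dom a `&` U)) (f \o param a).

Definition holo_map {q} {N : cmanifold R q} (F : M -> N) := continuous F /\
  forall a b, atlas M a -> atlas N b ->
    holo_on (a @` (dom a `&` F @^-1` dom b)) (b \o F \o param a).

End Kaehler.

(* A Riemannian cone structure on N = C \ {o}: a diffeomorphism
   (cone_r, cone_link) : N -> R_{>0} x S with inverse cone_pt, where S is a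
   closed Riemannian manifold. *)
Record cone (R : realType) (m : nat) (N : manifold R m.+1) := Cone {
  link : manifold R m;
  link_metric : link -> 'M[R]_m;
  cone_r : N -> R;
  cone_link : N -> link;
  cone_pt : R * link -> N;
  link_compact : compact [set: link];
  link_riemannian : riemannian link_metric;
  cone_r_gt0 : forall y, 0 < cone_r y;
  cone_ptK : forall y, cone_pt (cone_r y, cone_link y) = y;
  cone_rK : forall (t : R) s, 0 < t -> cone_r (cone_pt (t, s)) = t;
  cone_linkK : forall (t : R) s, 0 < t -> cone_link (cone_pt (t, s)) = s;
  cone_r_smooth : smooth_fun cone_r;
  cone_link_smooth : smooth_map cone_link;
  cone_pt_continuous : forall (t : R) s, 0 < t -> {for (t, s), continuous cone_pt};
  (* smoothness of cone_pt in the product charts (t, v) of R_{>0} x S *)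
  cone_pt_smooth : forall a b, atlas N a -> atlas link b ->
    let F (w : 'rV[R]_(1 + m)) := cone_pt (w 0 0, param b (rsubmx w)) in
    smooth_map_on
      [set w : 'rV[R]_(1 + m) | [/\ 0 < w 0 0, (b @` dom b) (rsubmx w) & dom a (F w)]]
      (a \o F) }.
Arguments link {R m N}.
Arguments link_metric {R m N}.
Arguments cone_r {R m N}.
Arguments cone_link {R m N}.
Arguments cone_pt {R m N}.

Section ConeGeometry.
Context {R : realType} {m : nat} {N : manifold R m.+1} (C : cone N).

(* dr^2 + r^2 g_S *)
Definition cone_metric (y : N) : 'M[R]_m.+1 :=
  (fdiff (cone_r C) y)^T *m fdiff (cone_r C) y
  + cone_r C y ^+ 2 *: pullback (cone_link C) (link_metric C) y.

(* r d/dr *)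
Definition radial (y : N) : 'rV[R]_m.+1 :=
  cone_r C y *:
    derive1 (fun t => chart_at y (cone_pt C (t, cone_link C y))) (cone_r C y).

End ConeGeometry.

(* the whole cone; None is the apex o *)
Definition cone_space {R : realType} {m : nat} {N : manifold R m.+1}
  (C : cone N) : Type := option N.

Section ConeTopology.
Context {R : realType} {m : nat} {N : manifold R m.+1} (C : cone N).

HB.instance Definition _ := Choice.on (cone_space C).

Definition cone_open (U : set (option N)) :=
  open (Some @^-1` U) /\
  (U None -> exists2 e : R, 0 < e & forall y, cone_r C y < e -> U (Some y)).

Program Definition cone_space_topology :=
  @isOpenTopological.Build (cone_space C) cone_open _ _ _.
Next Obligation.
by split=> [|_]; [rewrite preimage_setT; exact: openT | exists 1].
Qed.
Next Obligation.
move=> U V [oU U0] [oV V0]; split; first exact: openI.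
move=> [/U0 [e e0 Ue] /V0 [d d0 Vd]]; exists (Num.min e d).
  by rewrite lt_min e0.
by move=> y; rewrite lt_min => /andP[ye yd]; split; [exact: Ue | exact: Vd].
Qed.
Next Obligation.
move=> I f fo; split.
  by rewrite preimage_bigcup; apply: bigcup_open => i _; have [] := fo i.
move=> [i _ fi0]; have [_ /(_ fi0) [e e0 fe]] := fo i.
by exists e => // y /fe; exists i.
Qed.
HB.instance Definition _ := cone_space_topology.

End ConeTopology.

Section KaehlerCone.
Context {R : realType} {n : nat} {N : cmanifold R n.+1}.
Implicit Types (gC : N -> 'M[R]_(n.+1 + n.+1)).
Local Notation cone_on := (@cone R (n + n.+1) N).

Definition kaehler_cone (C : cone_on) gC :=
  kaehler gC /\ gC = cone_metric C.

(* xi = J (r d/dr) *)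
Definition reeb (C : cone_on) (y : N) : 'rV[R]_(n.+1 + n.+1) :=
  (radial C y : 'rV_(n.+1 + n.+1)) *m J0.

(* The Kaehler conical metrics on C: the cone structure may differ from C away
   from the apex, but the topological space and the apex are those of C. *)
Definition kaehler_conical (C : cone_on) gC :=
  exists C' : cone_on, kaehler_cone C' gC /\ cone_open C' = cone_open C.

(* Holomorphic functions on an open subset of the normal complex space C are
   the continuous ones that are holomorphic off the apex. *)
Definition cone_holo_fun (C : cone_on) (U : set (cone_space C))
    (f : cone_space C -> 'rV[R]_(1 + 1)) :=
  {in U, continuous f} /\
  holo_fun_on (Some @^-1` U) (f \o Some).

End KaehlerCone.

(* A resolution pi : M -> C, with exceptional set pi^-1(o) and inverse res_inv
   off the apex *)
Record resolution (R : realType) (n : nat) (M N : cmanifold R n.+1)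
    (C : @cone R (n + n.+1) N) := Resolution {
  res_map :> M -> cone_space C;
  res_inv : N -> M;
  res_continuous : continuous res_map;
  res_proper : forall K, compact K -> compact (res_map @^-1` K);
  res_surj : set_surj [set: M] [set: cone_space C] res_map;
  res_holo : forall (U : set (cone_space C)) f, open U -> cone_holo_fun U f ->
    holo_fun_on (res_map @^-1` U) (f \o res_map);
  res_invK : forall y, res_map (res_inv y) = Some y;
  res_mapK : forall x y, res_map x = Some y -> res_inv y = x;
  res_inv_holo : holo_map res_inv;
  (* pi is holomorphic as a map M \ E -> N *)
  res_map_holo : forall a b, atlas M a -> atlas N b ->
    holo_on (a @` (dom a `&` [set x | exists2 y, res_map x = Some y & dom b y]))
      (oapp b 0 \o res_map \o param a);
  res_dense : closure (res_map @^-1` [set~ None]) = [set: M] }.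

Section Asymptotics.
Context {R : realType} {n : nat} {M N : cmanifold R n.+1}.
Context {C : @cone R (n + n.+1) N} (pi : resolution M C).
Implicit Types (g : M -> 'M[R]_(n.+1 + n.+1)) (X : M -> 'rV[R]_(n.+1 + n.+1))
  (gC : N -> 'M[R]_(n.+1 + n.+1)).

(* d(pi) at x, where pi x = Some y *)
Definition res_diff (x : M) (y : N) : 'M[R]_(n.+1 + n.+1) :=
  jacobian (oapp (chart_at y) 0 \o pi \o param (chart_at x)) (chart_at x x).

Definition res_push g : N -> 'M[R]_(n.+1 + n.+1) := pullback (res_inv pi) g.

(* (M, g, X) is resolved by pi and asymptotic to (C, gC) *)
Definition asymptotic_to_cone g X gC :=
  (forall x y, pi x = Some y -> X x *m res_diff x y = radial C y) /\
  forall k : nat, exists Ck r0 : R, forall y, r0 < cone_r C y ->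
    nabla_norm gC (fun z => res_push g z - gC z) k y
      <= Ck * cone_r C y ^- (2 + k).

Definition self_similar (Phi : R -> M -> M) g (t : R) (x : M) :=
  t *: pullback (Phi t) g x.

(* (M, g, X) is a gradient expander with bounded curvature coming out of gC *)
Definition expands_from X (Phi : R -> M -> M) gC g :=
  [/\ gradient_expander g X, bounded_curvature g &
      locally_smooth_cvg (fun t => res_push (self_similar Phi g t)) gC].

End Asymptotics.

Section BL.
Context {R : realType} {m : nat}.
Local Open Scope ereal_scope.

Definition form_le (A B : 'M[R]_m) :=
  forall v : 'rV[R]_m, ((v *m A *m v^T) 0 0 <= (v *m B *m v^T) 0 0)%R.

Definition BL_pt (A B : 'M[R]_m) : \bar R :=
  ereal_inf [set s%:E | s in [set s : R |
    [/\ (0 <= s)%R, form_le (expR (- s) *: B) A & form_le A (expR s *: B)]]].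

Definition BL_sup {T : Type} (g1 g2 : T -> 'M[R]_m) : \bar R :=
  ereal_sup (range (fun x => BL_pt (g1 x) (g2 x))).

Definition at_infinity {M : manifold R m} (g : M -> 'M[R]_m) (p : M) :
    set_system M :=
  [set A | exists r : R, forall x, (r < distance g p x)%R -> A x].

Definition BL_inf {M : manifold R m} (g : M -> 'M[R]_m) (p : M)
    (g1 g2 : M -> 'M[R]_m) : \bar R :=
  limf_esup (fun x => BL_pt (g1 x) (g2 x)) (at_infinity g p).

End BL.

Definition conical_ball {R : realType} {n : nat} {N : cmanifold R n.+1}
    (C : @cone R (n + n.+1) N) (gC : N -> 'M[R]_(n.+1 + n.+1)) (delta : R) :
    set (N -> 'M[R]_(n.+1 + n.+1)) :=
  [set h | [/\ kaehler_conical C h, forall y, lie (reeb C) h y = 0 &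
               (BL_sup gC h <= delta%:E)%E]].

Section MetricSpaces.
Context {R : realType}.
Local Open Scope ereal_scope.

Definition is_metric {T : Type} (A : set T) (d : T -> T -> \bar R) :=
  [/\ forall x y, A x -> A y -> d x y \is a fin_num /\ 0 <= d x y,
      forall x y, A x -> A y -> d x y = 0 <-> x = y,
      forall x y, A x -> A y -> d x y = d y x &
      forall x y z, A x -> A y -> A z -> d x z <= d x y + d y z].

Definition is_isometry {T U : Type} (A : set T) (dA : T -> T -> \bar R)
    (B : set U) (dB : U -> U -> \bar R) (f : T -> U) :=
  set_bij A B f /\ forall x y, A x -> A y -> dB (f x) (f y) = dA x y.

End MetricSpaces.

(* Main.v *)
Require Import Defs.
From mathcomp Require Import all_boot all_order all_algebra.
From mathcomp Require Import all_classical all_reals all_analysis.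
From mathcomp Require Import ring lra.
Set Implicit Arguments. Unset Strict Implicit. Unset Printing Implicit Defensive.
Import Order.TTheory GRing.Theory Num.Theory numFieldNormedType.Exports.
Local Open Scope classical_set_scope.
Local Open Scope ring_scope.

(** Everything follows from the equality
    BL_inf (rho h) (rho k) = BL_sup h k for two metrics h, k of the ball
    (BL_inf_eq): BL_sup is a metric on the ball, since it is at most 2 delta, obeys
    the triangle inequality, and vanishes only if the two symmetric tensors have
    the same quadratic forms; injectivity of rho and all the metric axioms on its
    image are read off from the equality.

    The equality compares two descriptions of the same ratio of forms. BL at a
    point does not change when both forms undergo the same linear change of
    variables or the same rescaling, so comparing the self-similar solutions of
    rho h and rho k at the time t and the point y of the cone is comparing rho h
    and rho k at Phi_t(y) (self_similar_congr, close_evolve). As t tends to 0 the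
    point Phi_t(y) goes to infinity while the self-similar solutions converge to h
    and k. Hence a bound for BL near infinity is a bound for BL (h, k) at every y
    (close_cone). Conversely, a point of M with large radial coordinate r is
    Phi_t(y) with t = r^-2 and y on the link r = 1. The link is compact, so the
    convergence is uniform there and a bound for BL (h, k) is, up to an arbitrarily
    small loss, a bound for BL near infinity (close_at_infinity).

    Two facts about the geometry of M are needed for this.

    First, the flow: pi conjugates Phi_t to the dilation of the cone by t^(-1/2)
    (flow_dilation). Along a trajectory r^2 t and the link coordinate have
    derivative zero, as dpi(X) = r d/dr, and the trajectory cannot reach the
    exceptional set because r is then bounded below. This explicit formula
    also gives the differentiability of Phi_t off the exceptional set and the
    invertibility of its differential.

    Second, d_g(p, x) tends to infinity if and only if r does. One direction
    (radius_large) is properness of pi and the boundedness of d_g(p, .) on compact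
    sets, for which connectedness of M provides paths. The other one
    (distance_large) is that d_g controls r: the asymptotics of order zero give
    dr^2 <= 4 g far out (asymptotic_dr_bound), so that r grows along a path by
    at most twice the length of the path (radius_path_length). *)

(** * Quadratic forms *)

Section Forms.
Context {R : realType} {m : nat}.
Implicit Types (A B G P h : 'M[R]_m) (v w : 'rV[R]_m).

Definition qf A v : R := (v *m A *m v^T) 0 0.

Definition nonneg_form A := forall v, 0 <= qf A v.

Definition pos_form A := forall v, v != 0 -> 0 < qf A v.

Lemma qf0 A : qf A 0 = 0.
Proof. by rewrite /qf !mul0mx mxE. Qed.

Lemma pos_form_nonneg A : pos_form A -> nonneg_form A.
Proof.
by move=> pA v; have [->|/pA/ltW//] := eqVneq v 0; rewrite qf0.
Qed.

Lemma qfD A B v : qf (A + B) v = qf A v + qf B v.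
Proof. by rewrite /qf mulmxDr mulmxDl mxE. Qed.

Lemma qfN A v : qf (- A) v = - qf A v.
Proof. by rewrite /qf mulmxN mulNmx mxE. Qed.

Lemma qfZ c A v : qf (c *: A) v = c * qf A v.
Proof. by rewrite /qf -scalemxAr -scalemxAl mxE. Qed.

Lemma qfE A v : qf A v = \sum_i \sum_j v 0 i * A i j * v 0 j.
Proof.
rewrite /qf -mulmxA mxE; apply: eq_bigr => i _.
by rewrite mxE mulr_sumr; apply: eq_bigr => j _; rewrite mxE mulrA.
Qed.

Lemma qf1 v : qf 1%:M v = \sum_i v 0 i ^+ 2.
Proof.
rewrite /qf mulmx1 mxE; apply: eq_bigr => i _.
by rewrite mxE expr2.
Qed.

Lemma qf1_ge0 v : 0 <= qf 1%:M v.
Proof. by rewrite qf1 sumr_ge0 // => i _; rewrite sqr_ge0. Qed.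

(** Polarization. *)
Lemma qf_sym_eq A B : A^T = A -> B^T = B -> qf A =1 qf B -> A = B.
Proof.
move=> sA sB AB; apply/matrixP => i j.
pose e := delta_mx 0 i + delta_mx 0 j : 'rV[R]_m.
have bil (D : 'M[R]_m) k l :
    (delta_mx 0 k : 'rV_m) *m D *m (delta_mx 0 l : 'rV_m)^T = (D k l)%:M.
  rewrite -rowE; apply/matrixP => a b; rewrite !ord1 trmx_delta -colE !mxE.
  by rewrite eqxx mulr1n.
have ex (D : 'M[R]_m) : D^T = D -> qf D e = D i i + D j j + D i j *+ 2.
  move=> sD; rewrite /qf /e linearD /= !(mulmxDl, mulmxDr) !bil !mxE !mulr1n.
  have -> : D j i = D i j by rewrite -[in LHS]sD mxE.
  by rewrite mulr2n; ring.
have dg k : A k k = B k k.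
  have := AB (delta_mx 0 k); rewrite /qf !bil !mxE !mulr1n.
  by [].
have := AB e; rewrite !ex // !dg => /addrI.
by move/eqP; rewrite eqrMn2r ?orFb // => /eqP.
Qed.

End Forms.

Section Congruence.
Context {R : realType}.

Lemma qf_congr m k (P : 'M[R]_(k, m)) (A : 'M[R]_m) (v : 'rV[R]_k) :
  qf (P *m A *m P^T) v = qf A (v *m P).
Proof. by rewrite /qf trmx_mul !mulmxA. Qed.

Lemma form_le_congr m (P A B : 'M[R]_m) : P \in unitmx ->
  form_le (P *m A *m P^T) (P *m B *m P^T) <-> form_le A B.
Proof.
move=> uP; split=> AB v; last by have := AB (v *m P); rewrite -!/(qf _ _) !qf_congr.
by have := AB (v *m invmx P); rewrite -!/(qf _ _) !qf_congr -!mulmxA mulVmx ?mulmx1.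
Qed.

(** The Schur complement of the upper left entry splits a positive definite form
    on R^(1+m) into forms on R and R^m. *)
Lemma pos_form_diag_step m :
  (forall G : 'M[R]_m, G^T = G -> pos_form G ->
     exists2 P, P \in unitmx & P *m G *m P^T = 1%:M) ->
  forall G : 'M[R]_(1 + m), G^T = G -> pos_form G ->
  exists2 P, P \in unitmx & P *m G *m P^T = 1%:M.
Proof.
move=> IH G sG pG.
pose a := G 0 0; pose b := ursubmx G; pose D := drsubmx G.
have GE : G = block_mx a%:M b b^T D.
  rewrite -[LHS]submxK; congr block_mx.
    apply/matrixP => i j; rewrite !ord1 !mxE /= mulr1n.
    by rewrite /a; congr (G _ _); apply/val_inj.
  by rewrite /b -[in LHS]sG trmx_ursub.
have sD : D^T = D by rewrite /D trmx_drsub sG.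
have a0 : 0 < a.
  have := pG (row_mx 1%:M 0).
  rewrite GE /qf mul_row_block tr_row_mx mul_row_col !mul1mx !mul0mx !addr0.
  rewrite trmx0 mulmx0 addr0 trmx1 mulmx1 mxE mulr1n; apply.
  apply/eqP => /rowP/(_ (lshift m 0)); rewrite row_mxEl !mxE eqxx /=.
  by move/eqP; rewrite oner_eq0.
pose D' := D - a^-1 *: (b^T *m b).
pose E : 'M[R]_(1 + m) := block_mx 1%:M 0 (- (a^-1 *: b^T)) 1%:M.
have EGE : E *m G *m E^T = block_mx a%:M 0 0 D'.
  rewrite GE /E mulmx_block tr_block_mx mulmx_block.
  rewrite !trmx1 !trmx0 !mul1mx !mulmx1 !mul0mx !mulmx0 !addr0.
  have -> : a%:M *m (- (a^-1 *: b^T))^T = - b :> 'M[R]_(1, m).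
    rewrite linearN /= linearZ /= trmxK mulmxN -scalemxAr mul_scalar_mx scalerA.
    by rewrite mulVf ?gt_eqF // scale1r.
  have -> : - (a^-1 *: b^T) *m a%:M + b^T = 0.
    rewrite mulNmx mul_mx_scalar scalerA mulfV ?gt_eqF // scale1r.
    by rewrite addNr.
  rewrite addNr mul0mx add0r; congr block_mx.
  by rewrite /D' mulNmx -scalemxAl addrC.
have uE : E \in unitmx by rewrite unitmxE /E det_lblock !det1 mulr1 unitr1.
have sD' : D'^T = D'.
  by rewrite /D' linearB /= linearZ /= trmx_mul trmxK sD.
have pD' : pos_form D'.
  move=> v v0; have := pG (row_mx 0 v *m E).
  have -> : qf G (row_mx 0 v *m E) = qf D' v.
    rewrite -qf_congr EGE /qf [row_mx 0 v *m _]mul_row_block tr_row_mx mul_row_col.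
    by rewrite !mul0mx !mulmx0 !add0r mul0mx add0r.
  apply.
  apply/eqP => /(congr1 (mulmx^~ (invmx E))).
  rewrite mulmxK // mul0mx => /(congr1 rsubmx); rewrite row_mxKr linear0 => v00.
  by rewrite v00 eqxx in v0.
have [P uP PDP] := IH _ sD' pD'.
pose s := Num.sqrt a.
have s0 : s != 0 by rewrite sqrtr_eq0 -ltNge.
exists (block_mx (s^-1)%:M 0 0 P *m E).
  rewrite unitmx_mul uE andbT unitmxE det_lblock det_scalar1 unitrM.
  by rewrite -(unitmxE P) uP andbT unitfE invr_eq0.
rewrite trmx_mul !mulmxA -(mulmxA _ E) -(mulmxA _ _ E^T) EGE.
rewrite tr_block_mx !mulmx_block !trmx0 !mul0mx !mulmx0 !addr0 !add0r !mul0mx.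
rewrite PDP tr_scalar_mx -!scalar_mxM [RHS]scalar_mx_block; congr (block_mx _%:M _ _ _).
rewrite -(sqr_sqrtr (ltW a0)) -/s expr2 mulrA mulVf // mul1r mulfV //.
Qed.

(** A frame that is orthonormal for G. *)
Lemma pos_form_diag m (G : 'M[R]_m) : G^T = G -> pos_form G ->
  exists2 P, P \in unitmx & P *m G *m P^T = 1%:M.
Proof.
elim: m G => [|m IH] G sG pG; last exact: pos_form_diag_step.
by exists 1%:M; rewrite ?unitmx1 //; apply/matrixP => -[].
Qed.

End Congruence.

Section QuadraticBounds.
Context {R : realType} {m : nat}.
Implicit Types (A B G P h K : 'M[R]_m) (v w : 'rV[R]_m).

(** From 2|xy| <= x^2 + y^2. *)
Lemma qf_bound K v : `|qf K v| <= (\sum_i \sum_j `|K i j|) * qf 1%:M v.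
Proof.
have sq i : v 0 i ^+ 2 <= qf 1%:M v.
  rewrite qf1 (bigD1 i) //= lerDl sumr_ge0 // => k _; exact: sqr_ge0.
rewrite qfE mulr_suml (le_trans (ler_norm_sum _ _ _)) // ler_sum // => i _.
rewrite mulr_suml (le_trans (ler_norm_sum _ _ _)) // ler_sum // => j _.
rewrite mulrAC !normrM mulrC ler_wpM2l //.
have := sq i; have := sq j; rewrite -(real_normK (num_real (v 0 i))).
rewrite -(real_normK (num_real (v 0 j))).
set x := `|_|; set y := `|_|; move=> ? ?.
have : 0 <= (x - y) ^+ 2 by exact: sqr_ge0.
nra.
Qed.

(** Positive definiteness is an open condition: in a frame that is orthonormal for
    A, a perturbation of A is a perturbation of the identity. *)
Lemma pos_form_near A : A^T = A -> pos_form A ->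
  exists2 e, 0 < e & forall B, (forall i j, `|B i j - A i j| <= e) -> nonneg_form B.
Proof.
move=> sA pA; have [P uP PAP] := pos_form_diag sA pA.
pose C := 1 + \sum_i \sum_j `|(P *m P^T) i j|.
have C0 : 0 < C.
  rewrite ltr_pwDl // sumr_ge0 // => i _; rewrite sumr_ge0 //.
have lowA v : qf 1%:M v <= C * qf A v.
  have [w ->] : exists w, v = w *m P by exists (v *m invmx P); rewrite mulmxKV.
  rewrite -[qf A _]qf_congr -[leLHS]qf_congr PAP mulmx1.
  rewrite (le_trans (ler_norm _)) // (le_trans (qf_bound _ _)) //.
  by rewrite ler_wpM2r ?qf1_ge0 // lerDr.
pose e := (C * (1 + m%:R * m%:R))^-1.
have m0 : 0 < 1 + m%:R * m%:R :> R by rewrite ltr_pwDl // mulr_ge0.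
have e0 : 0 < e by rewrite invr_gt0 mulr_gt0.
exists e => // B AB v; rewrite -[0 <= _]/(0 <= qf B v).
have -> : qf B v = qf A v + qf (B - A) v by rewrite -qfD addrC subrK.
have := qf_bound (B - A) v.
have : (\sum_i \sum_j `|(B - A) i j|) <= m%:R * m%:R * e.
  rewrite -mulrA [m%:R * (_ * _)]mulr_natl -[X in _ *+ X]card_ord -sumr_const.
  apply: ler_sum => i _; rewrite mulr_natl -[X in _ *+ X]card_ord -sumr_const.
  by apply: ler_sum => j _; have := AB i j; rewrite !mxE.
have := lowA v; have := qf1_ge0 v; rewrite ler_norml.
set S := \sum_i _; set q := qf 1%:M v; set a := qf A v; set d := qf _ v.
move=> q0 qa Se /andP[dl _].
have : S * q <= m%:R * m%:R * e * q by rewrite ler_wpM2r.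
have : m%:R * m%:R * e * q <= C^-1 * q.
  rewrite ler_wpM2r // /e invfM mulrCA -[leRHS]mulr1 ler_pM2l ?invr_gt0 //.
  by rewrite ler_pdivrMr // mul1r lerDr.
have : C^-1 * q <= a by rewrite ler_pdivrMl.
lra.
Qed.

Lemma sum_tuple2 (I : finType) (F : 2.-tuple I -> R) :
  \sum_(s : 2.-tuple I) F s = \sum_i \sum_j F [tuple i; j].
Proof.
rewrite pair_big /=.
rewrite (reindex (fun x : I * I => [tuple x.1; x.2])) //=.
exists (fun s : 2.-tuple I => (tnth s 0, tnth s 1)) => [[i j] _|s _] //=.
by apply/val_inj; case: s => -[|i [|j []]] // ?.
Qed.

(* In a frame that is orthonormal for G, the norm of h is its Frobenius norm. *)
Lemma tensor_norm2 (G h : 'rV[R]_m -> 'M[R]_m) u (P : 'M[R]_m) :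
  P \in unitmx -> P *m G u *m P^T = 1%:M ->
  tensor_norm G 2 (tensor2 h) u =
  Num.sqrt (\sum_i \sum_j (P *m h u *m P^T) i j ^+ 2).
Proof.
move=> uP PGP; congr Num.sqrt.
have iG : invmx (G u) = P^T *m P.
  have PTP : P^T *m P *m G u = 1%:M.
    have : P *m G u *m P^T *m P = P by rewrite PGP mul1mx.
    move/(congr1 (mulmx (invmx P))).
    by rewrite -!mulmxA mulKmx // mulVmx // => /mulmx1C; rewrite mulmxA.
  have uG : G u \in unitmx by case/mulmx1_unit: PTP.
  by rewrite -[RHS](mulmxK uG) PTP mul1mx.
pose K := P *m h u *m P^T.
transitivity (\tr (K *m K^T)); last first.
  apply: eq_bigr => i _; rewrite mxE; apply: eq_bigr => j _.
  by rewrite [K^T _ _]mxE expr2.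
rewrite /K !trmx_mul trmxK !mulmxA mxtrace_mulC !mulmxA -iG -!mulmxA (mulmxA P^T) -iG.
rewrite sum_tuple2; set V := invmx (G u).
have sV k i : V k i = V i k.
  by rewrite /V iG -[in LHS](trmxK P) -trmx_mul trmxK mxE.
transitivity (\sum_i \sum_j \sum_k \sum_l V i k * V j l * (h u i j * h u k l)).
  apply: eq_bigr => i _; apply: eq_bigr => j _.
  rewrite sum_tuple2; apply: eq_bigr => k _; apply: eq_bigr => l _.
  by rewrite !big_ord_recl big_ord0 mulr1.
under eq_bigr do rewrite exchange_big /=.
rewrite exchange_big /=; apply: eq_bigr => k _; rewrite mxE; apply: eq_bigr => i _.
rewrite mxE mulr_sumr; apply: eq_bigr => j _.
rewrite mxE mulr_sumr mulr_sumr; apply: eq_bigr => l _.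
by rewrite !mxE sV; ring.
Qed.

(** A tensor of norm e differs from zero, as a form, by at most a multiple of e G.
    The sharp constant is 1. *)
Lemma tensor_norm2_bound (G h : 'rV[R]_m -> 'M[R]_m) u v :
  (G u)^T = G u -> pos_form (G u) ->
  `|qf (h u) v| <= m%:R * m%:R * tensor_norm G 2 (tensor2 h) u * qf (G u) v.
Proof.
move=> sG pG; have [P uP PGP] := pos_form_diag sG pG.
have [w ->] : exists w, v = w *m P by exists (v *m invmx P); rewrite mulmxKV.
rewrite -!qf_congr PGP (tensor_norm2 h uP PGP).
rewrite (le_trans (qf_bound _ _)) // ler_wpM2r ?qf1_ge0 //.
set K := P *m h u *m P^T; set N := Num.sqrt _.
have KN i j : `|K i j| <= N.
  rewrite -sqrtr_sqr ler_wsqrtr // (bigD1 i) //= (bigD1 j) //= -addrA lerDl.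
  by rewrite addr_ge0 // !sumr_ge0 // => *; rewrite ?sumr_ge0 // => *; rewrite sqr_ge0.
rewrite -mulrA [m%:R * (_ * _)]mulr_natl -[X in _ *+ X]card_ord -sumr_const.
apply: ler_sum => i _; rewrite mulr_natl -[X in _ *+ X]card_ord -sumr_const.
exact: ler_sum.
Qed.

End QuadraticBounds.

(** * The distance BL of quadratic forms and of metrics *)

Section BLPoint.
Context {R : realType} {m : nat}.
Implicit Types (A B D P : 'M[R]_m) (s : R).

(** The condition that the infimum in BL ranges over, in a form that is visibly
    symmetric in A and B. *)
Definition close_forms s A B :=
  form_le B (expR s *: A) /\ form_le A (expR s *: B).

Lemma form_le_expN s A B :
  form_le (expR (- s) *: B) A <-> form_le B (expR s *: A).
Proof.
by split=> BA v; have := BA v; rewrite -!/(qf _ _) !qfZ expRN ler_pdivrMl ?expR_gt0.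
Qed.

Lemma close_forms_refl A : close_forms 0 A A.
Proof. by split=> v; rewrite expR0 scale1r. Qed.

Lemma close_forms_trans s t A B D :
  close_forms s A B -> close_forms t B D -> close_forms (s + t) A D.
Proof.
move=> [BA AB] [DB BD]; split=> v; rewrite -!/(qf _ _) qfZ expRD.
  have := DB v; have := BA v; rewrite -!/(qf _ _) !qfZ => b d.
  by rewrite (le_trans d) // [expR s * _]mulrC -mulrA ler_pM2l ?expR_gt0.
have := BD v; have := AB v; rewrite -!/(qf _ _) !qfZ => a b.
by rewrite (le_trans a) // -mulrA ler_pM2l ?expR_gt0.
Qed.

Lemma close_forms_congr s P A B : P \in unitmx ->
  close_forms s (P *m A *m P^T) (P *m B *m P^T) <-> close_forms s A B.
Proof.
move=> uP; rewrite /close_forms.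
have E c (D : 'M[R]_m) : c *: (P *m D *m P^T) = P *m (c *: D) *m P^T.
  by rewrite -scalemxAr -scalemxAl.
by rewrite !E !form_le_congr.
Qed.

Lemma close_formsZ s c A B : 0 < c ->
  close_forms s (c *: A) (c *: B) <-> close_forms s A B.
Proof.
move=> c0; split=> -[BA AB]; split=> v.
- by have := BA v; rewrite -!/(qf _ _) !qfZ mulrCA ler_pM2l.
- by have := AB v; rewrite -!/(qf _ _) !qfZ mulrCA ler_pM2l.
- by have := BA v; rewrite -!/(qf _ _) !qfZ mulrCA ler_pM2l.
- by have := AB v; rewrite -!/(qf _ _) !qfZ mulrCA ler_pM2l.
Qed.

Lemma close_forms_le s t A B : nonneg_form A -> nonneg_form B -> s <= t ->
  close_forms s A B -> close_forms t A B.
Proof.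
move=> pA pB st [BA AB]; split=> v.
  by apply: le_trans (BA v) _; rewrite -!/(qf _ _) !qfZ ler_wpM2r ?ler_expR.
by apply: le_trans (AB v) _; rewrite -!/(qf _ _) !qfZ ler_wpM2r ?ler_expR.
Qed.

(** If b > 0 and a > expR s * b, the midpoint of s and ln (a / b) contradicts
    the hypothesis. *)
Lemma le_expR_limit (a b s : R) : 0 <= b ->
  (forall t, s < t -> a <= expR t * b) -> a <= expR s * b.
Proof.
rewrite le_eqVlt => /predU1P[<-|b0] ab.
  by rewrite mulr0 (le_trans (ab (s + 1) _)) ?mulr0 // ltrDl.
rewrite leNgt; apply/negP => ba.
have a0 : 0 < a by apply: le_lt_trans ba; rewrite mulr_ge0 ?expR_ge0 // ltW.
have q0 : 0 < a / b by rewrite divr_gt0.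
have sl : s < ln (a / b) by rewrite -ltr_expR lnK // ltr_pdivlMr.
have := ab ((s + ln (a / b)) / 2); rewrite midf_lt // => /(_ isT).
apply/negP; rewrite -ltNge.
by rewrite -ltr_pdivlMr // -[X in _ < X]lnK // ltr_expR midf_lt.
Qed.

Lemma close_forms_limit s A B : nonneg_form A -> nonneg_form B ->
  (forall t, s < t -> close_forms t A B) -> close_forms s A B.
Proof.
move=> pA pB AB; split=> v; rewrite -!/(qf _ _) qfZ;
  apply: le_expR_limit => // t /AB[BA' AB'].
  by rewrite -qfZ; exact: BA'.
by rewrite -qfZ; exact: AB'.
Qed.

Lemma close_forms0 A B : A^T = A -> B^T = B -> close_forms 0 A B -> A = B.
Proof.
move=> sA sB [BA AB]; apply: qf_sym_eq => // v.
apply/eqP; rewrite eq_le; have := BA v; have := AB v.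
by rewrite expR0 !scale1r -!/(qf _ _) => -> ->.
Qed.

(** The infimum in BL is attained, so BL can be handled through the inequalities
    between forms that it encodes. *)
Lemma BL_pt_le s A B : nonneg_form A -> nonneg_form B -> 0 <= s ->
  (BL_pt A B <= s%:E)%E <-> close_forms s A B.
Proof.
move=> pA pB s0; split=> [BLs|[BA AB]]; last first.
  by apply: ereal_inf_lbound; exists s => //=; split=> //; exact/form_le_expN.
apply: close_forms_limit => // t st.
have /ereal_inf_lt[_ [r [r0 BA AB] <-]] : (BL_pt A B < t%:E)%E.
  by rewrite (le_lt_trans BLs) // lte_fin.
rewrite lte_fin => /ltW rt; apply: close_forms_le rt _ => //; split=> //.
exact/form_le_expN.
Qed.

Lemma BL_pt_ge0 A B : (0 <= BL_pt A B)%E.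
Proof. by apply: le_ereal_inf_tmp => _ [s [s0 _ _] <-]; rewrite lee_fin. Qed.

End BLPoint.

Section BLSup.
Context {R : realType} {m : nat} {T : Type}.
Implicit Types (h : T -> 'M[R]_m) (s : R).

Definition nonneg_tensor h := forall x, nonneg_form (h x).

Lemma BL_sup_le s h k : nonneg_tensor h -> nonneg_tensor k -> 0 <= s ->
  (BL_sup h k <= s%:E)%E <-> forall x, close_forms s (h x) (k x).
Proof.
move=> ph pk s0; split=> [BLs x|hk].
  apply/BL_pt_le => //; apply: le_trans BLs.
  by apply: ereal_sup_ubound; exists x.
by apply: ge_ereal_sup => _ [x _ <-]; exact/BL_pt_le.
Qed.

Lemma BL_sup_ge0 h k (x : T) : (0 <= BL_sup h k)%E.
Proof.
by apply: le_trans (BL_pt_ge0 (h x) (k x)) _; apply: ereal_sup_ubound; exists x.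
Qed.

Lemma BL_sup_sym h k : nonneg_tensor h -> nonneg_tensor k ->
  BL_sup h k = BL_sup k h.
Proof.
move=> ph pk; congr ereal_sup; apply: eq_imagel => x _.
rewrite /BL_pt; congr (ereal_inf (_ @` _)).
by apply/seteqP; split=> s /= [s0 a b]; split=> //; exact/form_le_expN.
Qed.

Lemma BL_sup_refl h (x : T) : nonneg_tensor h -> BL_sup h h = 0%E.
Proof.
move=> ph; apply/eqP; rewrite eq_le BL_sup_ge0 // andbT.
by apply/BL_sup_le => // y; exact: close_forms_refl.
Qed.

Lemma BL_sup_eq0 h k : nonneg_tensor h -> nonneg_tensor k ->
  (forall x, (h x)^T = h x) -> (forall x, (k x)^T = k x) ->
  (BL_sup h k <= 0)%E -> h = k.
Proof.
move=> ph pk sh sk /BL_sup_le hk; apply/funext => x.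
by apply: close_forms0 => //; exact: hk.
Qed.

Lemma BL_sup_triangle h k l (x : T) :
  nonneg_tensor h -> nonneg_tensor k -> nonneg_tensor l ->
  (BL_sup h l <= BL_sup h k + BL_sup k l)%E.
Proof.
move=> ph pk pl.
have := BL_sup_ge0 h k x; have := BL_sup_ge0 k l x.
case hk : (BL_sup h k) => [a| |] //; case kl : (BL_sup k l) => [b| |] // b0 a0;
  rewrite ?leey //.
rewrite -EFinD; apply/BL_sup_le => //; first by rewrite addr_ge0.
move=> y; apply: (@close_forms_trans _ _ _ _ _ (k y)).
  by apply: (BL_sup_le ph pk a0).1; rewrite hk.
by apply: (BL_sup_le pk pl b0).1; rewrite kl.
Qed.

End BLSup.

(** * Differential calculus in charts *)

Section Differentials.
Context {R : realType}.

Lemma near_eq_differentiable (V W : normedModType R) (f g : V -> W) x :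
  {near x, f =1 g} -> differentiable f x ->
  differentiable g x /\ 'd g x = 'd f x :> (V -> W).
Proof.
move=> fg df.
have gE : g \o shift x = cst (g x) + 'd f x +o_ 0 id.
  have /diff_locally/eqaddoP fE := df.
  have fg0 : \forall h \near (0 : V), f (h + x) = g (h + x).
    have : (fun h : V => h + x) @ (0 : V) --> x.
      by rewrite -[X in _ --> X]add0r; apply: cvgD; [exact: cvg_id|exact: cvg_cst].
    by move/(_ _ fg).
  apply/eqaddoP => e e0; have := fE e e0; apply: filterS2 fg0 => h /= fgh.
  rewrite /shift /= /cst; rewrite !fctE /= /cst.
  by rewrite -fgh -(nbhs_singleton fg).
have dg := diff_unique (@diff_continuous _ _ _ (nbhs x) f df) gE.
split; last exact: dg.
by apply/diff_locallyP; rewrite dg; split=> //; exact: diff_continuous.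
Qed.

Lemma differentiable_rV (V : normedModType R) k (F : V -> 'rV[R]_k) x :
  (forall j, differentiable (fun u => F u 0 j) x) -> differentiable F x.
Proof.
move=> dF; have -> : F = \sum_j (fun u => F u 0 j *: delta_mx 0 j).
  apply/funext => u; rewrite fct_sumE; apply/rowP => j.
  by rewrite [LHS](congr1 (fun w : 'rV_k => w 0 j) (row_sum_delta (F u))).
by apply: differentiable_sum => j; exact: differentiableZl.
Qed.

Lemma jacobianE k l (F : 'rV[R]_k -> 'rV[R]_l) u v : v *m 'J F u = 'd F u v.
Proof. by rewrite mul_rV_lin1. Qed.

Lemma jacobian_comp k l m (F : 'rV[R]_k -> 'rV[R]_l) (G : 'rV[R]_l -> 'rV[R]_m) u :
  differentiable F u -> differentiable G (F u) ->
  'J (G \o F) u = 'J F u *m 'J G (F u).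
Proof.
move=> dF dG; apply/row_matrixP => i; rewrite !rowE mulmxA !jacobianE.
by rewrite diff_comp.
Qed.

Lemma jacobian_id k (F : 'rV[R]_k -> 'rV[R]_k) u :
  {near u, F =1 id} -> 'J F u = 1%:M.
Proof.
move=> Fid; apply/row_matrixP => i; rewrite !rowE jacobianE mulmx1.
have did : differentiable (id : 'rV[R]_k -> _) u by [].
have [|_ ->] := @near_eq_differentiable _ _ id F u _ did.
  by apply: filterS Fid => v ->.
by rewrite diff_val.
Qed.

Lemma near_eq_jacobian k l (F G : 'rV[R]_k -> 'rV[R]_l) u :
  {near u, F =1 G} -> differentiable F u -> 'J F u = 'J G u.
Proof.
move=> FG dF; apply/row_matrixP => i.
rewrite [LHS]rowE [RHS]rowE.
rewrite [LHS]jacobianE.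
rewrite [RHS]jacobianE.
have [_ dGF] := near_eq_differentiable FG dF.
exact/esym/(congr1 (fun d : 'rV_k -> 'rV_l => d (delta_mx 0 i)) dGF).
Qed.

(** The local form of the vanishing derivative criterion, by the mean value
    theorem on the segment from x to y. *)
Lemma near_derive0_cst (f : R -> R) (x : R) :
  (\forall y \near x, is_derive y (1 : R) f 0) -> \forall y \near x, f y = f x.
Proof.
case=> e /= e0 f0; exists e => //= y xy.
have seg (a b : R) : a <= b -> (forall c : R, a <= c <= b -> is_derive c (1 : R) f 0) -> f a = f b.
  move=> ab fab.
  have fab' (c : R) : c \in `[a, b] -> is_derive c (1 : R) f 0.
    by move/itvP => ci; apply: fab; rewrite !ci.
  have [c _] := @MVT_segment R f (fun=> 0) a b ab
    (fun c ci => fab' c (subset_itv_oo_cc ci))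
    (@derivable_within_continuous R R f `[a, b] (fun c ci => @ex_derive _ _ _ _ _ _ _ (fab' c ci))).
  by rewrite mul0r => /subr0_eq.
have near_f0 (c : R) : Num.min x y <= c <= Num.max x y -> is_derive c (1 : R) f 0.
  move=> xcy; apply: f0; apply: le_lt_trans xy; rewrite /ball_ /=.
  move: xcy; case: (leP x y) => xy /andP[l u].
    by rewrite !ler0_norm ?subr_le0 // !opprB lerB.
  by rewrite !ger0_norm ?subr_ge0 // ?lerB // ltW.
case: (leP x y) near_f0 => xy' H; first exact/esym/seg.
by apply: seg => //; exact: ltW.
Qed.

End Differentials.

(* From here on Jacobians are used only through the lemmas above. *)
Local Opaque jacobian.

Section Charts.
Context {R : realType} {m : nat} {M : manifold R m}.
Implicit Types (a b : chart R M m) (x : M).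

Lemma coord_img a x : dom a x -> (a @` dom a) (a x).
Proof. by exists x. Qed.

Lemma param_dom a u : (a @` dom a) u -> dom a (param a u).
Proof. by case=> x ax <-; rewrite coordK. Qed.

Lemma paramK a u : (a @` dom a) u -> a (param a u) = u.
Proof. by case=> x ax <-; rewrite coordK. Qed.

Lemma near_dom a x : dom a x -> \near x, dom a x.
Proof. by move=> ax; apply: open_nbhs_nbhs; split=> //; exact: dom_open. Qed.

Lemma near_img a x : dom a x -> \forall u \near a x, (a @` dom a) u.
Proof.
move=> ax; apply: open_nbhs_nbhs; split; [exact: img_open|exact: coord_img].
Qed.

Lemma param_cvg a x : dom a x -> param a @ a x --> x.
Proof.
by move=> ax; rewrite -[X in _ --> X](coordK ax); apply/param_continuous/coord_img.
Qed.

Lemma near_paramK a x : dom a x -> {near a x, a \o param a =1 id}.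
Proof. by move=> /near_img; apply: filterS => u; exact: paramK. Qed.

Lemma differentiable_transition a b x : atlas M a -> atlas M b ->
  dom a x -> dom b x -> differentiable (b \o param a) (a x).
Proof.
move=> Aa Ab ax bx; apply: differentiable_rV => j.
by apply: (@transition_smooth _ _ M a b Aa Ab j [::]); exists x.
Qed.

(** The chain rule through a manifold. Continuity of phi keeps its values in the
    domain of b near u; all the chain rules below are instances. *)
Lemma diff_through_chart (U W : normedModType R) b (phi : U -> M) (f : M -> W) u :
  {for u, continuous phi} -> dom b (phi u) ->
  differentiable (b \o phi) u -> differentiable (f \o param b) (b (phi u)) ->
  differentiable (f \o phi) u /\
  'd (f \o phi) u = 'd (f \o param b) (b (phi u)) \o 'd (b \o phi) u :> (U -> W).
Proof.
move=> cphi bphi dphi df.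
have E : {near u, (f \o param b) \o (b \o phi) =1 f \o phi}.
  have : \forall v \near u, dom b (phi v) by apply: cphi; exact: near_dom.
  by apply: filterS => v bv; rewrite /= coordK.
have dc := differentiable_comp dphi df.
have [d1 d2] := near_eq_differentiable E dc.
by split=> //; rewrite d2 diff_comp.
Qed.

(** The transition map back is a local inverse. *)
Lemma unitmx_frame a x : atlas M a -> dom a x -> frame a x \in unitmx.
Proof.
move=> Aa ax; pose b := chart_at x.
have Ab : atlas M b by exact: chart_at_atlas.
have bx : dom b x by exact: dom_chart_at.
have dab := differentiable_transition Aa Ab ax bx.
have dba := differentiable_transition Ab Aa bx ax.
have dba' : differentiable (a \o param b) ((b \o param a) (a x)) by rewrite /= coordK.
have : 'J (b \o param a) (a x) *m 'J (a \o param b) ((b \o param a) (a x)) = 1%:M.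
  rewrite -(jacobian_comp dab dba'); apply: jacobian_id.
  have : \forall u \near a x, dom b (param a u) by apply: param_cvg (near_dom bx).
  by apply: filterS2 (near_img ax) => u au bu; rewrite /= coordK // paramK.
by rewrite /frame -/b => /mulmx1_unit[uJ _]; exact: uJ.
Qed.

Lemma frame_chart_at x : frame (chart_at x) x = 1%:M.
Proof. by rewrite /frame; apply: jacobian_id; exact: near_paramK (dom_chart_at x). Qed.

Lemma tcoord_chart_at (h : M -> 'M[R]_m) x :
  tcoord (chart_at x) h (chart_at x x) = h x.
Proof.
by rewrite /tcoord coordK ?frame_chart_at ?mul1mx ?trmx1 ?mulmx1 //; exact: dom_chart_at.
Qed.

Lemma tcoordE a (h : M -> 'M[R]_m) x : dom a x ->
  tcoord a h (a x) = frame a x *m h x *m (frame a x)^T.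
Proof. by move=> ax; rewrite /tcoord coordK. Qed.

End Charts.

Section ManifoldMaps.
Context {R : realType}.

Definition mdifferentiable m p (M : manifold R m) (N : manifold R p) (F : M -> N) x :=
  {for x, continuous F} /\
  differentiable (chart_at (F x) \o F \o param (chart_at x)) (chart_at x x).

Definition fdifferentiable p (N : manifold R p) (W : normedModType R) (f : N -> W) y :=
  differentiable (f \o param (chart_at y)) (chart_at y y).

Context {m p : nat} {M : manifold R m} {N : manifold R p}.

Lemma near_eq_mdiff (F G : M -> N) x : {near x, F =1 G} ->
  mdifferentiable F x -> mdifferentiable G x /\ mdiff F x = mdiff G x.
Proof.
move=> FG [cF dF]; have FGx := nbhs_singleton FG.
have ax := dom_chart_at x.
have E : {near chart_at x x, chart_at (F x) \o F \o param (chart_at x) =1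
                             chart_at (G x) \o G \o param (chart_at x)}.
  have : \forall u \near chart_at x x, F (param (chart_at x) u) = G (param (chart_at x) u).
    by have := param_cvg ax FG.
  by apply: filterS => u FGu /=; rewrite FGu FGx.
have [dG dE] := near_eq_differentiable E dF.
split; last exact: near_eq_jacobian.
split; last exact: dG.
rewrite /prop_for /continuous_at -FGx.
by apply: cvg_trans cF; apply: near_eq_cvg.
Qed.

Lemma mdiff_fcomp (W : normedModType R) (F : M -> N) (f : N -> W) x :
  mdifferentiable F x -> fdifferentiable f (F x) ->
  fdifferentiable (f \o F) x /\
  'd (f \o F \o param (chart_at x)) (chart_at x x) =
  'd (f \o param (chart_at (F x))) (chart_at (F x) (F x)) \o
  'd (chart_at (F x) \o F \o param (chart_at x)) (chart_at x x) :> ('rV_m -> W).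
Proof.
move=> [cF dF] df.
have ax := dom_chart_at x.
have e : (F \o param (chart_at x)) (chart_at x x) = F x by rewrite /= coordK.
have := @diff_through_chart _ _ _ _ W (chart_at (F x)) (F \o param (chart_at x)) f (chart_at x x).
rewrite e => /(_ _ _ dF df); apply.
- rewrite /prop_for /continuous_at e.
  exact: (cvg_comp _ _ (param_cvg ax) cF).
- exact: dom_chart_at.
Qed.

End ManifoldMaps.

Section Composition.
Context {R : realType} {m p q : nat}.
Context {M : manifold R m} {N : manifold R p} {L : manifold R q}.

Lemma mdiff_comp (F : M -> N) (G : N -> L) x :
  mdifferentiable F x -> mdifferentiable G (F x) ->
  mdifferentiable (G \o F) x /\ mdiff (G \o F) x = mdiff F x *m mdiff G (F x).
Proof.
move=> dF [cG dG].
have [d1 d2] := @mdiff_fcomp _ _ _ _ _ _ F (chart_at (G (F x)) \o G) x dF dG.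
split.
  split; first by have [cF _] := dF; exact: continuous_comp.
  exact: d1.
apply/row_matrixP => i; rewrite !rowE mulmxA.
rewrite [LHS]jacobianE.
rewrite [X in _ = X *m _]jacobianE [RHS]jacobianE.
exact: (congr1 (fun d : 'rV_m -> 'rV_q => d (delta_mx 0 i)) d2).
Qed.

End Composition.

Lemma mdiff_inverse (R : realType) m p (M : manifold R m) (N : manifold R p)
    (F : M -> N) (G : N -> M) x :
  mdifferentiable F x -> mdifferentiable G (F x) -> {near x, G \o F =1 id} ->
  mdiff F x *m mdiff G (F x) = 1%:M.
Proof.
move=> dF dG GF; have [dGF <-] := mdiff_comp dF dG.
have [_ ->] := near_eq_mdiff GF dGF.
apply: jacobian_id.
exact/near_paramK/dom_chart_at.
Qed.

(** * Cones and their resolutions *)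

(** A resolution of a cone as a map of real manifolds: a proper map that restricts
    to a diffeomorphism, with inverse psi, from the complement of the exceptional
    set onto the cone without its apex. *)
Record cone_resolution (R : realType) (m : nat) (M N : manifold R m.+1)
    (C : cone N) (pi : M -> cone_space C) (psi : N -> M) : Prop := ConeResolution {
  cr_continuous : continuous pi;
  cr_proper : forall K, compact K -> compact (pi @^-1` K);
  cr_invK : forall y, pi (psi y) = Some y;
  cr_mapK : forall x y, pi x = Some y -> psi y = x;
  cr_inv_diff : forall y, mdifferentiable psi y;
  cr_map_diff : forall x y, pi x = Some y ->
    differentiable (oapp (chart_at y) 0 \o pi \o param (chart_at x)) (chart_at x x) }.

Section ConeCoordinates.
Context {R : realType} {m : nat} {N : manifold R m.+1} (C : cone N).

Lemma cone_r_diff y : fdifferentiable (cone_r C) y.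
Proof.
apply: (@cone_r_smooth _ _ _ C (chart_at y) (chart_at_atlas y) [::]).
exact/coord_img/dom_chart_at.
Qed.

Definition cone_dr y (u : 'rV[R]_m.+1) : R :=
  'd (cone_r C \o param (chart_at y)) (chart_at y y) u.

Lemma cone_r_continuous : continuous (cone_r C).
Proof.
move=> y; have ay := dom_chart_at y.
have c1 : cone_r C \o param (chart_at y) @ chart_at y y --> cone_r C y.
  have e : (cone_r C \o param (chart_at y)) (chart_at y y) = cone_r C y.
    by rewrite /= coordK.
  by rewrite -[X in _ --> X]e; exact: differentiable_continuous (cone_r_diff y).
have c2 : (cone_r C \o param (chart_at y)) \o chart_at y @ y --> cone_r C y.
  have c0 : chart_at y @ y --> chart_at y y := Defs.coord_continuous ay.
  exact: (cvg_comp _ _ c0 c1).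
apply: cvg_trans c2; apply: near_eq_cvg.
by apply: filterS (near_dom ay) => z az /=; rewrite coordK.
Qed.

Lemma cone_link_continuous : continuous (cone_link C).
Proof. by case: (cone_link_smooth C). Qed.

Lemma cone_link_diff b y j : atlas (link C) b -> dom b (cone_link C y) ->
  fdifferentiable (fun y' => b (cone_link C y') 0 j) y.
Proof.
have [_ /(_ (chart_at y) b (chart_at_atlas y))] := cone_link_smooth C.
move=> /[apply] /(_ j [::]) + by_.
by apply; exists y => //; split=> //; exact: dom_chart_at.
Qed.

(** The inverse polar coordinates (t, s) |-> cone_pt (t, s), read in a chart of
    the link. *)
Lemma cone_pt_diff y t s : 0 < t -> cone_pt C (t, s) = y ->
  differentiable (fun w : 'rV[R]_(1 + m) =>
      chart_at y (cone_pt C (w 0 0, param (chart_at s) (rsubmx w))))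
    (row_mx t%:M (chart_at s s)).
Proof.
move=> t0 ty; apply: differentiable_rV => j.
have := @cone_pt_smooth _ _ _ C (chart_at y) (chart_at s)
  (chart_at_atlas y) (chart_at_atlas s) j [::].
have w0 : (row_mx t%:M (chart_at s s) : 'rV[R]_(1 + m)) 0 0 = t.
  have -> : 0 = lshift m 0 :> 'I_(1 + m) by apply/val_inj.
  by rewrite row_mxEl mxE eqxx mulr1n.
apply; split; rewrite /= ?w0 //.
  by rewrite row_mxKr; exact/coord_img/dom_chart_at.
by rewrite row_mxKr coordK ?ty; exact: dom_chart_at.
Qed.

Definition ray y (t : R) : N := cone_pt C (t, cone_link C y).

Lemma ray_r y : ray y (cone_r C y) = y.
Proof. exact: cone_ptK. Qed.

Lemma ray_continuous y t : 0 < t -> {for t, continuous (ray y)}.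
Proof.
move=> t0.
have ct : (fun t' => (t', cone_link C y)) @ t --> (t, cone_link C y).
  exact: (@cvg_pair R R (link C) (nbhs t) (nbhs t) (nbhs (cone_link C y))
    _ _ _ id (cst (cone_link C y)) cvg_id (cvg_cst _)).
have cp : cone_pt C @ (t, cone_link C y) --> cone_pt C (t, cone_link C y).
  exact: cone_pt_continuous.
exact: (cvg_comp _ _ ct cp).
Qed.

Lemma ray_diff y : differentiable (chart_at y \o ray y) (cone_r C y).
Proof.
have r0 := cone_r_gt0 C y; have s_dom := dom_chart_at (cone_link C y).
pose e (t : R) : 'rV[R]_(1 + m) := row_mx t%:M (chart_at (cone_link C y) (cone_link C y)).
have dF := cone_pt_diff r0 (cone_ptK C y).
have de : differentiable e (cone_r C y).
  apply: differentiable_rV => j; case: (split_ordP j) => k ->.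
    rewrite (_ : (fun _ => _) = id) //.
    by apply/funext => t; rewrite /e row_mxEl mxE !ord1 eqxx mulr1n.
  rewrite (_ : (fun _ => _) = cst (chart_at (cone_link C y) (cone_link C y) 0 k)) //.
  by apply/funext => t; rewrite /e row_mxEr.
have := differentiable_comp (f := e) de dF; set G := (_ \o e) => dG.
suff -> : chart_at y \o ray y = G by [].
apply/funext => t; rewrite /G /= /ray.
have -> : e t 0 0 = t.
  have -> : 0 = lshift m 0 :> 'I_(1 + m) by apply/val_inj.
  by rewrite row_mxEl mxE eqxx mulr1n.
by rewrite row_mxKr coordK.
Qed.

(** The radial field is r times the velocity of the rays. *)
Lemma diff_radial (W : normedModType R) (f : N -> W) y : fdifferentiable f y ->
  'd (f \o param (chart_at y)) (chart_at y y) (radial C y) =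
  cone_r C y *: 'D_1 (f \o ray y) (cone_r C y).
Proof.
move=> df; have r0 := cone_r_gt0 C y.
have dr := ray_diff y.
have := @diff_through_chart _ _ _ _ W (chart_at y) (ray y) f (cone_r C y)
   (ray_continuous (y := y) r0).
rewrite ray_r => /(_ (dom_chart_at y) dr df)[d1 d2].
by rewrite deriveE // d2 /= /radial linearZ derive1E deriveE.
Qed.

End ConeCoordinates.

(** The Jacobian is that of pi in the charts at x and y, so this is
    dpi(X) = r d/dr. *)
Definition lifts_radial {R : realType} {m : nat} {M N : manifold R m.+1} {C : cone N}
    (pi : M -> cone_space C) (X : M -> 'rV[R]_m.+1) :=
  forall x y, pi x = Some y ->
    X x *m 'J (oapp (chart_at y) 0 \o pi \o param (chart_at x)) (chart_at x x) =
    radial C y.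

(** Under this condition a k-unit speed path that stays where r > r1 changes r at
    a rate of at most 2. *)
Definition dominates_dr {R : realType} {m : nat} {N : manifold R m.+1} (C : cone N)
    (k : N -> 'M[R]_m.+1) (r1 : R) :=
  forall y, r1 < cone_r C y -> forall u, cone_dr C y u ^+ 2 <= 4 * qf (k y) u.

Section ConeResolutionMaps.
Context {R : realType} {m : nat} {M N : manifold R m.+1} {C : cone N}.
Context { pi : M -> cone_space C} {psi : N -> M} (rs : cone_resolution pi psi).
Implicit Types (x : M) (y z : N).

(** pi as a map to the cone without its apex. The default value z is taken on the
    exceptional set, near which this map is never used. *)
Definition cone_proj z x : N := odflt z (pi x).

Lemma near_cone_point x y (P : N -> Prop) : pi x = Some y -> nbhs y P ->
  \forall x' \near x, exists2 y', pi x' = Some y' & P y'.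
Proof.
move=> pxy; rewrite nbhsE => -[U [oU Uy] UP].
have oS : open (Some @` U : set (cone_space C)).
  split; last by case.
  rewrite (_ : _ @^-1` _ = U) //; apply/seteqP; split=> [u [v Uv [<-]]|u Uu] //.
  by exists u.
have : \forall x' \near x, (Some @` U : set (cone_space C)) (pi x').
  apply: (cr_continuous rs); apply: open_nbhs_nbhs; split=> //.
  by rewrite pxy; exists y.
by apply: filterS => x' [y' Uy' <-]; exists y' => //; exact: UP.
Qed.

Lemma cone_proj_psi z y : cone_proj z (psi y) = y.
Proof. by rewrite /cone_proj (cr_invK rs). Qed.

Lemma near_off_exceptional x y : pi x = Some y ->
  \forall x' \near x, exists y', pi x' = Some y'.
Proof.
move=> pxy; have nT : nbhs y [set: N] by exact: filterT.
by have := near_cone_point pxy nT; apply: filterS => x' [y' px' _]; exists y'.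
Qed.

Lemma near_psi_proj x y z : pi x = Some y -> {near x, psi \o cone_proj z =1 id}.
Proof.
move=> /near_off_exceptional; apply: filterS => x' [y' px'].
by rewrite /cone_proj /= px' /= (cr_mapK rs px').
Qed.

(** The conclusion on mdiff identifies it with the differential of pi as it
    appears in the hypothesis on X. *)
Lemma cone_proj_mdiff x y z : pi x = Some y ->
  mdifferentiable (cone_proj z) x /\
  mdiff (cone_proj z) x =
    'J (oapp (chart_at y) 0 \o pi \o param (chart_at x)) (chart_at x x).
Proof.
move=> pxy; have pr_x : cone_proj z x = y by rewrite /cone_proj pxy.
have ax := dom_chart_at x.
have E : {near chart_at x x, oapp (chart_at y) 0 \o pi \o param (chart_at x) =1
                             chart_at y \o cone_proj z \o param (chart_at x)}.
  have : \forall u \near chart_at x x, exists y', pi (param (chart_at x) u) = Some y'.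
    by have := param_cvg ax (near_off_exceptional pxy).
  by apply: filterS => u [y' pu]; rewrite /= /cone_proj /= pu.
have dpi := cr_map_diff rs pxy.
split; last by rewrite /mdiff pr_x; exact/esym/near_eq_jacobian.
split; last by have [d _] := near_eq_differentiable E dpi; rewrite pr_x; exact: d.
rewrite /prop_for /continuous_at pr_x => A yA.
have := near_cone_point pxy yA.
by apply: filterS => x' [y' px' Ay']; rewrite /= /cone_proj px'.
Qed.

Lemma mdiff_psi_unit y : mdiff psi y \in unitmx.
Proof.
have [dq _] := cone_proj_mdiff y (cr_invK rs y).
have : {near y, cone_proj y \o psi =1 id}.
  by apply: nearW => y'; exact: cone_proj_psi.
by move/(mdiff_inverse (cr_inv_diff rs y) dq)/mulmx1_unit => [u _]; exact: u.
Qed.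

Section Flow.
Context {X : M -> 'rV[R]_m.+1} {Phi : R -> M -> M}.
Context (X_radial : lifts_radial pi X) (flow : expander_flow X Phi).

(** The trajectory has velocity - X / (2t), and X lies over r d/dr. *)
Lemma is_derive_flow (W : normedModType R) (f : N -> W) x y z t :
  0 < t -> pi (Phi t x) = Some y -> fdifferentiable f y ->
  is_derive t (1 : R) (fun s => f (cone_proj z (Phi s x)))
    (- (2 * t)^-1 *: (cone_r C y *: 'D_1 (f \o ray C y) (cone_r C y))).
Proof.
move=> t0 pty df; have [_ /(_ x t t0)[cPhi dPhi]] := flow.
have [dq qJ] := cone_proj_mdiff z pty.
have qy : cone_proj z (Phi t x) = y by rewrite /cone_proj pty.
have [d1 d2] : _ /\ _ := @mdiff_fcomp _ _ _ _ _ W (cone_proj z) f (Phi t x) dq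
  (eq_ind_r (fun y => fdifferentiable f y) df qy).
have dP : differentiable (chart_at (Phi t x) \o Phi^~ x) t.
  by apply/derivable1_diffP; exact: ex_derive.
have [d3 d4] := @diff_through_chart _ _ _ _ W (chart_at (Phi t x)) (Phi^~ x)
  (f \o cone_proj z) t cPhi (dom_chart_at _) dP d1.
apply: DeriveDef; first exact/derivable1_diffP.
have e1 : 'D_1 ((f \o cone_proj z) \o Phi^~ x) t = 'd ((f \o cone_proj z) \o Phi^~ x) t 1.
  exact: deriveE d3.
have e2 := congr1 (fun d : R -> W => d 1) d4.
have e3 : 'd (chart_at (Phi t x) \o Phi^~ x) t 1 = - (2 * t)^-1 *: X (Phi t x).
  by have [_ <-] := dPhi; exact/esym/(deriveE _ dP).
have e4 := congr1 (fun d : 'rV_m.+1 -> W => d (X (Phi t x))) d2.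
have e5 : 'd (chart_at (cone_proj z (Phi t x)) \o cone_proj z \o param (chart_at (Phi t x)))
    (chart_at (Phi t x) (Phi t x)) (X (Phi t x)) = radial C y.
  by rewrite -jacobianE -(X_radial pty) -qJ.
rewrite -[LHS]/('D_1 ((f \o cone_proj z) \o Phi^~ x) t) {}e1 {}e2.
rewrite /= {}e3 linearZ; congr (_ *: _).
move: e4; rewrite /= => ->.
rewrite -(diff_radial C df) qy; congr ('d _ _ _).
by rewrite -e5 qy.
Qed.

End Flow.

End ConeResolutionMaps.
Arguments cone_proj {R m M N C} pi z x.

(** * The flow of - X / (2t) is a family of dilations *)

Section FlowOnCone.
Context {R : realType} {m : nat} {M N : manifold R m.+1} {C : cone N}.
Context { pi : M -> cone_space C} {psi : N -> M} (rs : cone_resolution pi psi).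
Context {X : M -> 'rV[R]_m.+1} {Phi : R -> M -> M}.
Context (X_radial : lifts_radial pi X) (flow : expander_flow X Phi).
Implicit Types (x : M) (y z : N) (s t : R).

Lemma flow_continuous x t : 0 < t -> Phi^~ x @ t --> Phi t x.
Proof. by move=> t0; have [_ /(_ x t t0)[]] := flow. Qed.

Lemma derive_cone_r_ray y : 'D_1 (cone_r C \o ray C y) (cone_r C y) = 1.
Proof.
rewrite (@near_eq_derive _ _ _ _ id) ?derive_id //.
have : \forall t \near cone_r C y, 0 < t by apply: lt_nbhsr; exact: cone_r_gt0.
by apply: filterS => t t0; rewrite /= /ray cone_rK.
Qed.

Lemma derive_cone_link_ray (g : link C -> R) y :
  'D_1 ((g \o cone_link C) \o ray C y) (cone_r C y) = 0.
Proof.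
rewrite (@near_eq_derive _ _ _ _ (cst (g (cone_link C y)))) ?derive_cst //.
have : \forall t \near cone_r C y, 0 < t by apply: lt_nbhsr; exact: cone_r_gt0.
by apply: filterS => t t0; rewrite /= /ray cone_linkK.
Qed.

(** The trajectory lies over a curve of velocity - r / (2t) d/dr, along which r^2 t
    and the coordinates of the link have derivative zero. *)
Lemma flow_local x y t : 0 < t -> pi (Phi t x) = Some y ->
  \forall s \near t, 0 < s /\ exists y', [/\ pi (Phi s x) = Some y',
    cone_r C y' ^+ 2 * s = cone_r C y ^+ 2 * t & cone_link C y' = cone_link C y].
Proof.
move=> t0 pty; pose q s := cone_proj pi y (Phi s x).
pose b := chart_at (cone_link C y).
have near_y P : nbhs y P ->
    \forall s \near t, exists2 y', pi (Phi s x) = Some y' & P y'.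
  by move=> /(near_cone_point rs pty) yP; have := flow_continuous (x := x) t0 yP.
have near_b : nbhs y (fun y' => dom b (cone_link C y')).
  by apply: cone_link_continuous; exact/near_dom/dom_chart_at.
have near_t : \forall s \near t, 0 < s by exact: lt_nbhsr.
have qE s y' : pi (Phi s x) = Some y' -> q s = y' by rewrite /q /cone_proj => ->.
have const_r : \forall s \near t, cone_r C (q s) ^+ 2 * s = cone_r C (q t) ^+ 2 * t.
  apply: (near_derive0_cst (f := fun s => cone_r C (q s) ^+ 2 * s)).
  apply: filterS2 near_t (near_y _ near_b) => s s0 [y' psy' _].
  have := is_derive_flow rs X_radial flow y s0 psy' (cone_r_diff C y').
  rewrite derive_cone_r_ray -/q => dr.
  have dr2 : is_derive s (1 : R) (fun s => cone_r C (q s))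
    (- (2 * s)^-1 *: (cone_r C y' *: 1)) by exact: dr.
  apply: is_derive_eq.
  rewrite (qE _ _ psy').
  rewrite /GRing.scale /=; field; exact: lt0r_neq0.
have const_link j : \forall s \near t, b (cone_link C (q s)) 0 j = b (cone_link C (q t)) 0 j.
  apply: (near_derive0_cst (f := fun s => b (cone_link C (q s)) 0 j)).
  apply: filterS2 near_t (near_y _ near_b) => s s0 [y' psy' by'].
  have Ab : atlas (link C) b by exact: chart_at_atlas.
  have := is_derive_flow rs X_radial flow y s0 psy' (cone_link_diff j Ab by').
  by rewrite (derive_cone_link_ray (fun l => b l 0 j)) !scaler0.
have const_b : \forall s \near t, forall j, b (cone_link C (q s)) 0 j = b (cone_link C (q t)) 0 j.
  exact: (@filter_forall _ _
    (fun j s => b (cone_link C (q s)) 0 j = b (cone_link C (q t)) 0 j) (nbhs t) _ const_link).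
have qt : q t = y by exact: qE.
rewrite qt in const_r const_b.
near=> s; split; first by near: s.
have : exists2 y', pi (Phi s x) = Some y' & dom b (cone_link C y') by near: s; exact: near_y.
move=> [y' psy' by']; exists y'; split=> //.
  by rewrite -(qE _ _ psy'); near: s.
rewrite -(coordK by'); have by_ : dom b (cone_link C y) by exact: dom_chart_at.
rewrite -[RHS](coordK by_); congr (param b _); apply/rowP => j.
by rewrite -(qE _ _ psy'); move: j; near: s; exact: const_b.
Unshelve. all: by end_near. Qed.

(** The set of times at which r^2 t and the link coordinate have kept their
    values is open and closed in ]0, oo[. It is closed because r^2 t > 0 keeps the
    trajectory away from the apex. *)
Lemma flow_invariants y t : 0 < t ->
  exists y', [/\ pi (Phi t (psi y)) = Some y',
    cone_r C y' ^+ 2 * t = cone_r C y ^+ 2 & cone_link C y' = cone_link C y].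
Proof.
pose x := psi y; pose r0 := cone_r C y.
have r00 : 0 < r0 by exact: cone_r_gt0.
pose A : set R := [set s | 0 < s /\ exists y', [/\ pi (Phi s x) = Some y',
    cone_r C y' ^+ 2 * s = r0 ^+ 2 & cone_link C y' = cone_link C y]].
suff AE : A = [set s : R | 0 < s] by move=> t0; have [] : A t by rewrite AE.
have c0 : connected [set s : R | 0 < s].
  apply/connected_intervalP => a b /= a0 b0 c /andP[ac _].
  exact: lt_le_trans ac.
apply: c0.
- exists 1; split=> //; exists y; have [-> _] := flow.
  by rewrite (cr_invK rs) mulr1.
- exists A°; first exact: open_interior.
  apply/seteqP; split=> [s [s0 [y' [psy' ry' ly']]]|s [_ /interior_subset//]].
  split=> //; have := flow_local s0 psy'; apply: filterS => u [u0 [z [puz rz lz]]].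
  by split=> //; exists z; rewrite rz lz.
exists (closure A); first exact: closed_closure.
apply/seteqP; split=> [s As|s [/= s0 cs]].
  by split; [by case: As|exact: subset_closure].
case psy : (pi (Phi s x)) => [y'|].
  have [u [[u0 [z [puz rz lz]]] [_ [z' [puz' rz' lz']]]]] := cs _ (flow_local s0 psy).
  move: puz'; rewrite puz => -[zz']; split=> //; exists y'.
  by rewrite psy -rz' -lz' -zz' rz lz.
(* If pi (Phi s x) were the apex, r would be smaller than e at times u close to s
   and hence, for u < 2 s, r^2 u would be smaller than r0^2. *)
pose e := r0 / (1 + 2 * s).
have s1 : 0 < 1 + 2 * s by rewrite addr_gt0 // mulr_gt0.
have e0 : 0 < e by rewrite divr_gt0.
pose U : set (cone_space C) := [set w | if w is Some z then cone_r C z < e else True].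
have oU : open U.
  split; last by move=> _; exists e.
  rewrite (_ : _ @^-1` _ = cone_r C @^-1` [set r | r < e]); last by [].
  by apply: open_comp; [move=> z _; exact: cone_r_continuous|exact: open_lt].
have nU : \forall u \near s, U (pi (Phi u x)).
  have : nbhs (pi (Phi s x)) U by apply: open_nbhs_nbhs; split=> //; rewrite psy.
  by move=> /(cr_continuous rs) /(flow_continuous s0).
have n2 : \forall u \near s, u < 2 * s by apply: lt_nbhsl; rewrite ltr_pMl // ltr1n.
have [u [[u0 [z [puz rz lz]]] [Uu u2]]] := cs _ (filterI nU n2).
move: Uu; rewrite puz /U => /= rze.
have : r0 ^+ 2 < r0 ^+ 2.
  rewrite -[X in X < _]rz.
  have r1 : cone_r C z ^+ 2 < e ^+ 2 by rewrite ltr_pXn2r // ?nnegrE ltW // cone_r_gt0.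
  have h1 : cone_r C z ^+ 2 * u < e ^+ 2 * (2 * s).
    apply: ltr_pM => //; [exact: sqr_ge0|exact: ltW].
  apply: (lt_le_trans h1); rewrite /e expr_div_n -mulrA ler_piMr ?sqr_ge0 //.
  rewrite mulrC ler_pdivrMr ?exprn_gt0 // mul1r; nra.
by rewrite ltxx.
Qed.

(** The two invariants determine the position at time t. *)
Lemma flow_dilation y t : 0 < t ->
  Phi t (psi y) = psi (cone_pt C (cone_r C y / Num.sqrt t, cone_link C y)).
Proof.
move=> t0; have [y' [pty' ry' ly']] := flow_invariants y t0.
rewrite -(cr_mapK rs pty') -[y' in LHS](cone_ptK C) ly'; congr (psi (cone_pt C (_, _))).
have st0 : 0 < Num.sqrt t by rewrite sqrtr_gt0.
apply/eqP; rewrite -(@eqrXn2 _ 2) //; last 2 first.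
- exact/ltW/cone_r_gt0.
- by rewrite divr_ge0 // ltW // cone_r_gt0.
by rewrite expr_div_n sqr_sqrtr ?(ltW t0) // -ry' mulfK // lt0r_neq0.
Qed.

End FlowOnCone.

Section Dilations.
Context {R : realType} {m : nat} {N : manifold R m.+1} (C : cone N).
Implicit Types (y : N) (c : R).

Definition dilate c y : N := cone_pt C (c * cone_r C y, cone_link C y).

Lemma dilate_continuous c : 0 < c -> continuous (dilate c).
Proof.
move=> c0 y; have cr0 : 0 < c * cone_r C y by rewrite mulr_gt0 // cone_r_gt0.
have c1 : (fun y => c * cone_r C y) @ y --> c * cone_r C y.
  exact: cvgM (cvg_cst c) (@cone_r_continuous _ _ _ C y).
have c2 := @cvg_pair N R (link C) (nbhs y) (nbhs (c * cone_r C y)) (nbhs (cone_link C y))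
  _ _ _ _ _ c1 (@cone_link_continuous _ _ _ C y).
have c3 : cone_pt C @ (c * cone_r C y, cone_link C y) -->
    cone_pt C (c * cone_r C y, cone_link C y) by exact: cone_pt_continuous.
by have := cvg_comp _ _ (c2 _ _ _) c3; apply.
Qed.

(** The coordinates of dilate c are cone_pt applied to c r and to the link
    coordinate. *)
Lemma dilate_mdiff c y : 0 < c -> mdifferentiable (dilate c) y.
Proof.
move=> c0; have cr0 : 0 < c * cone_r C y by rewrite mulr_gt0 // cone_r_gt0.
split; first exact: dilate_continuous.
pose s := cone_link C y; have ay := dom_chart_at y; have bs := dom_chart_at s.
have dF := cone_pt_diff cr0 (erefl (dilate c y)).
pose e (u : 'rV[R]_m.+1) : 'rV[R]_(1 + m) :=
  row_mx (c * cone_r C (param (chart_at y) u))%:M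
         (chart_at s (cone_link C (param (chart_at y) u))).
have e_y : e (chart_at y y) = row_mx (c * cone_r C y)%:M (chart_at s s).
  by rewrite /e coordK.
have de : differentiable e (chart_at y y).
  apply: differentiable_rV => j; case: (split_ordP j) => k ->.
    rewrite (_ : (fun _ => _) = fun u => c *: (cone_r C \o param (chart_at y)) u); last first.
      by apply/funext => u; rewrite /e row_mxEl mxE !ord1 eqxx mulr1n.
    by apply: differentiableZ; exact: cone_r_diff.
  rewrite (_ : (fun _ => _) =
      (fun y' => chart_at s (cone_link C y') 0 k) \o param (chart_at y)); last first.
    by apply/funext => u; rewrite /e row_mxEr.
  exact: (cone_link_diff k (chart_at_atlas s) bs).
have dFe : differentiable (fun w : 'rV[R]_(1 + m) =>
    chart_at (dilate c y) (cone_pt C (w 0 0, param (chart_at s) (rsubmx w)))) (e (chart_at y y)).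
  by rewrite e_y.
have dG := differentiable_comp de dFe.
apply: (near_eq_differentiable _ dG).1.
have : \forall u \near chart_at y y, dom (chart_at s) (cone_link C (param (chart_at y) u)).
  have c1 : \forall y' \near y, dom (chart_at s) (cone_link C y').
    by apply: cone_link_continuous; exact: near_dom.
  by have := param_cvg ay c1.
apply: filterS => u su; rewrite /= /dilate.
have -> : e u 0 0 = c * cone_r C (param (chart_at y) u).
  have -> : 0 = lshift m 0 :> 'I_(1 + m) by apply/val_inj.
  by rewrite row_mxEl mxE eqxx mulr1n.
by rewrite row_mxKr coordK.
Qed.

Lemma dilateK c y : 0 < c -> dilate c^-1 (dilate c y) = y.
Proof.
move=> c0; have cr0 : 0 < c * cone_r C y by rewrite mulr_gt0 // cone_r_gt0.
by rewrite /dilate cone_rK // cone_linkK // mulKf ?cone_ptK // lt0r_neq0.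
Qed.

Lemma mdiff_dilate_unit c y : 0 < c -> mdiff (dilate c) y \in unitmx.
Proof.
move=> c0; have ci : 0 < c^-1 by rewrite invr_gt0.
have near_id : {near y, dilate c^-1 \o dilate c =1 id}.
  by apply: nearW => y'; exact: dilateK.
have := mdiff_inverse (dilate_mdiff y c0) (dilate_mdiff (dilate c y) ci) near_id.
by move/mulmx1_unit => [u _]; exact: u.
Qed.

End Dilations.

Section SelfSimilar.
Context {R : realType} {m : nat} {M N : manifold R m.+1} {C : cone N}.
Context { pi : M -> cone_space C} {psi : N -> M} (rs : cone_resolution pi psi).
Context {X : M -> 'rV[R]_m.+1} {Phi : R -> M -> M}.
Context (X_radial : lifts_radial pi X) (flow : expander_flow X Phi).

Lemma mdiff_cone_proj_unit x y z : pi x = Some y -> mdiff (cone_proj pi z) x \in unitmx.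
Proof.
move=> pxy; have [dq _] := cone_proj_mdiff rs z pxy.
have := mdiff_inverse dq (cr_inv_diff rs _) (near_psi_proj rs z pxy).
by move/mulmx1_unit => [u _]; exact: u.
Qed.

(** Near psi y the map Phi_t is psi \o dilate (t^(-1/2)) \o pi, a composition of
    local diffeomorphisms. *)
Lemma flow_mdiff_unit y (t : R) : 0 < t -> mdiff (Phi t) (psi y) \in unitmx.
Proof.
move=> t0; pose c := (Num.sqrt t)^-1; have c0 : 0 < c by rewrite invr_gt0 sqrtr_gt0.
have py := cr_invK rs y.
pose q := cone_proj pi y; have qy : q (psi y) = y by exact: cone_proj_psi.
have [dq _] := cone_proj_mdiff rs y py; rewrite -/q in dq.
have dd : mdifferentiable (dilate C c) (q (psi y)) by exact: dilate_mdiff.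
have [d1 e1] := mdiff_comp dq dd.
have [d2 e2] := mdiff_comp d1 (cr_inv_diff rs _).
have E : {near psi y, psi \o (dilate C c \o q) =1 Phi t}.
  have := near_off_exceptional rs py; apply: filterS => x [y' pxy'].
  rewrite -(cr_mapK rs pxy') (flow_dilation rs X_radial flow) //=.
  by rewrite /q cone_proj_psi // /dilate mulrC.
have [_ <-] := near_eq_mdiff E d2.
have u1 := mdiff_cone_proj_unit y py.
have u2 := mdiff_dilate_unit C (q (psi y)) c0.
have u3 := mdiff_psi_unit rs (dilate C c (q (psi y))).
have u12 : mdiff (dilate C c \o q) (psi y) \in unitmx.
  by rewrite e1 unitmx_mul; apply/andP; split; [exact: u1|exact: u2].
by rewrite e2 unitmx_mul; apply/andP; split; [exact: u12|exact: u3].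
Qed.

(** Q is the differential of Phi_t \o psi at y. That it does not depend on g is
    what makes two self-similar solutions comparable. *)
Lemma self_similar_congr y (t : R) : 0 < t ->
  exists2 Q, Q \in unitmx & forall g : M -> 'M[R]_m.+1,
    pullback psi (fun x => t *: pullback (Phi t) g x) y = t *: (Q *m g (Phi t (psi y)) *m Q^T).
Proof.
move=> t0; exists (mdiff psi y *m mdiff (Phi t) (psi y)).
  rewrite unitmx_mul; apply/andP; split; first exact: mdiff_psi_unit rs y.
  exact: flow_mdiff_unit.
move=> g; rewrite /pullback.
by rewrite -scalemxAr -scalemxAl trmx_mul !mulmxA.
Qed.

End SelfSimilar.

(** * Lengths of paths and distance to the base point *)

Section Growth.
Context {R : realType}.
Implicit Types (f F : R -> R) (t s B : R).

Lemma within_itv_continuous f (a b : R) :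
  (forall t, a <= t <= b -> f @ t --> f t) -> {within `[a, b], continuous f}.
Proof.
move=> cf; apply: continuous_in_subspaceT => t.
by rewrite inE /= in_itv /= => /cf.
Qed.

Lemma Rintegral_le_cst F B : (forall t, 0 <= t <= 1 -> F @ t --> F t) ->
  (forall t, 0 <= t <= 1 -> F t <= B) ->
  \int[lebesgue_measure]_(t in `[0%R, 1%R]%classic) F t <= B.
Proof.
move=> cF FB.
have -> : B = \int[lebesgue_measure]_(t in `[0%R, 1%R]%classic) cst B t.
  rewrite Rintegral_cst //= lebesgue_measure_itv /= lte_fin ltr01.
  by rewrite -EFinB subr0 mulr1.
apply: le_Rintegral => //.
- apply: continuous_compact_integrable; first exact: segment_compact.
  exact: within_itv_continuous.
- apply: continuous_compact_integrable; first exact: segment_compact.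
  by apply: continuous_subspaceT => t; exact: cvg_cst.
Qed.

(** After the last time at which f <= B, the difference 2 \int F - f is
    nondecreasing. *)
Lemma growth_above_threshold f F B :
  (forall t, 0 <= t <= 1 -> f @ t --> f t) ->
  (forall t, 0 <= t <= 1 -> F @ t --> F t) ->
  (forall t, 0 <= F t) -> f 0 <= B ->
  (forall t, 0 <= t <= 1 -> B < f t ->
     derivable f t 1 /\ f^`()%classic t <= 2 * F t) ->
  f 1 <= B + 2 * \int[lebesgue_measure]_(t in `[0%R, 1%R]%classic) F t.
Proof.
move=> cf cF F0 f0B df.
pose J t := \int[lebesgue_measure]_(u in `[0%R, t]%classic) F u.
have J0 t : 0 <= J t by apply: Rintegral_ge0 => u _; exact: F0.
rewrite -/(J 1); have [f1B|Bf1] := leP (f 1) B.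
  by rewrite (le_trans f1B) // lerDl mulr_ge0.
pose S := [set t | 0 <= t <= 1 /\ f t <= B].
have S0 : S 0 by split; rewrite // lexx ler01.
have ubS : ubound S 1 by move=> t [/andP[]].
have hubS : has_ubound S by exists 1.
have supS : has_sup S by split=> //; exists 0.
pose t0 := sup S.
have t00 : 0 <= t0 by exact: (ub_le_sup hubS S0).
have t01 : t0 <= 1 by exact: (ge_sup (ex_intro _ 0 S0) ubS).
have ft0 : f t0 <= B.
  rewrite leNgt; apply/negP => Bft0.
  have : \forall t \near t0, B < f t.
    have ct0 : f @ t0 --> f t0 by apply: cf; rewrite t00.
    by have := ct0 _ (lt_nbhsr Bft0).
  case=> e /= e0 He; have [s Ss] := sup_adherent e0 supS.
  have st0 : s <= t0 by exact: (ub_le_sup hubS Ss).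
  rewrite -/t0 => es; case: (Ss) => _; apply/negP; rewrite -ltNge; apply: He.
  by rewrite /ball_ /= ger0_norm ?subr_ge0 // ltrBlDl -ltrBlDr.
have above t : t0 < t -> t <= 1 -> B < f t.
  move=> t0t t1; rewrite ltNge; apply/negP => ftB.
  have : t <= t0.
    apply: (ub_le_sup hubS).
    by split=> //; rewrite t1 (le_trans t00) // ltW.
  by rewrite leNgt t0t.
have iF : lebesgue_measure.-integrable `[0%R, 1%R] (EFin \o F).
  apply: continuous_compact_integrable; first exact: segment_compact.
  exact: within_itv_continuous.
have cJ : {within `[0%R, 1%R], continuous J}.
  exact: parameterized_integral_continuous ler01 iF.
have dJ t : 0 < t -> t < 1 -> derivable J t 1 /\ J^`()%classic t = F t.
  move=> t_gt0 t_lt1; apply: (continuous_FTC1_closed t_lt1 iF) => //.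
  by apply: cF; rewrite !ltW.
pose k t := J t + J t - f t.
have dk t : t \in `]t0, 1[ -> is_derive t (1 : R) k (F t + F t - f^`()%classic t).
  rewrite in_itv /= => /andP[t0t t1].
  have tt : 0 <= t <= 1 by rewrite (le_trans t00) ltW.
  have [dft _] := df t tt (above t t0t (ltW t1)).
  have [dJt JF] := dJ t (le_lt_trans t00 t0t) t1.
  rewrite -JF !derive1E.
  have d1 := derivableP dJt; have d2 := derivableP dft.
  exact: is_deriveB.
have k01 : k t0 <= k 1.
  have ck : {within `[t0, 1%R], continuous k}.
    have cJ2 : {within `[t0, 1%R], continuous J}.
      by apply: (continuous_subspaceW _ cJ); apply: subset_itvr; rewrite bnd_simp.
    have cf2 : {within `[t0, 1%R], continuous f}.
      apply: within_itv_continuous => v /andP[v0 v1]; apply: cf.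
      by rewrite v1 (le_trans t00).
    move=> u; have cJu : J @ (nbhs u) --> J u by exact: cJ2.
    have cfu : f @ (nbhs u) --> f u by exact: cf2.
    have := cvgB (cvgD cJu cJu) cfu.
    apply; exact: subspace_filter.
  have dk1 t : t \in `]t0, 1[ -> derivable k t 1 by move=> /dk [].
  apply: (ger0_derive1_le_cc dk1 _ ck) => //; rewrite ?in_itv /= ?lexx ?t01 //.
  move=> t tt; rewrite derive1E; have [_ ->] := dk t tt.
  move: tt; rewrite in_itv /= => /andP[t0t t1].
  have tt : 0 <= t <= 1 by rewrite (le_trans t00) ltW.
  by have [_ ?] := df t tt (above t t0t (ltW t1)); lra.
move: k01 ft0 (J0 t0); rewrite /k; lra.
Qed.

End Growth.

Lemma filter_forall2 (T : Type) (F : set_system T) (I J : finType)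
    (P : I -> J -> set T) : Filter F ->
  (forall i j, \forall x \near F, P i j x) -> \forall x \near F, forall i j, P i j x.
Proof.
move=> FF H.
have H1 i : \forall x \near F, forall j, P i j x.
  exact: (@filter_forall T J (P i) F FF (H i)).
exact: (@filter_forall T I (fun i x => forall j, P i j x) F FF H1).
Qed.

Section Paths.
Context {R : realType} {m : nat} {M : manifold R m}.
Implicit Types (g : M -> 'M[R]_m) (a : chart R M m) (c : R -> 'rV[R]_m).

Lemma tcoord_continuous g a u i j : smooth_tensor g -> atlas M a ->
  (a @` dom a) u -> (fun v => tcoord a g v i j) @ u --> tcoord a g u i j.
Proof.
move=> sg Aa au; apply: differentiable_continuous.
exact: (sg a Aa i j [::] u au).
Qed.

Definition speed g a c (t : R) : R :=
  Num.sqrt (qf (tcoord a g (c t)) (derive1 c t)).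

Lemma speed_ge0 g a c t : 0 <= speed g a c t.
Proof. exact: sqrtr_ge0. Qed.

Lemma speed_cvg g a c (t : R) : smooth_tensor g -> atlas M a ->
  c @ t --> c t -> derive1 c @ t --> derive1 c t -> (a @` dom a) (c t) ->
  speed g a c @ t --> speed g a c t.
Proof.
move=> sg Aa ct dct act.
suff Q : (fun s => qf (tcoord a g (c s)) (derive1 c s)) @ t -->
    qf (tcoord a g (c t)) (derive1 c t).
  exact: (cvg_comp _ _ Q (@sqrt_continuous R _)).
have -> : (fun s => qf (tcoord a g (c s)) (derive1 c s)) = fun s => \sum_i \sum_j
   derive1 c s 0 i * tcoord a g (c s) i j * derive1 c s 0 j.
  by apply/funext => s; rewrite qfE.
rewrite [X in _ --> X]qfE.
have cd i : (fun s => derive1 c s 0 i) @ t --> derive1 c t 0 i.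
  exact: (cvg_comp _ _ dct (@coord_continuous R _ _ 0 i (derive1 c t))).
have ch i j : (fun s => tcoord a g (c s) i j) @ t --> tcoord a g (c t) i j.
  have h := tcoord_continuous (i := i) (j := j) sg Aa act.
  by have := cvg_comp _ _ ct h.
apply: cvg_big => [|i _]; first exact: add_continuous.
apply: cvg_big => [|j _]; first exact: add_continuous.
exact: cvgM (cvgM (cd i) (ch i j)) (cd j).
Qed.

Lemma path_length_ge0 g x y L : path_length g x y L -> 0 <= L.
Proof.
elim=> // a c z l _ _ _ _ _ l0; rewrite addr_ge0 //.
by apply: Rintegral_ge0 => t _; exact: sqrtr_ge0.
Qed.

Lemma path_length_trans g x y z L K :
  path_length g x y L -> path_length g y z K -> path_length g x z (L + K).
Proof.
move=> xy; elim: xy z K => [w|a c w l Aa dc c1 ac _ IH] z K wz.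
  by rewrite add0r.
by rewrite -addrA; apply: PathCons => //; exact: IH.
Qed.

Lemma coord_le_norm (w : 'rV[R]_m) i : `|w 0 i| <= `|w|.
Proof.
rewrite [leRHS]/Num.Def.normr /= mx_normrE.
exact: (le_bigmax _ (fun ij : 'I_1 * 'I_m => `|w ij.1 ij.2|) (0, i)).
Qed.

Lemma is_derive_line (u w : 'rV[R]_m) (t : R) :
  is_derive t (1 : R) (fun t => u + t *: w) w.
Proof.
have d1 : is_derive t (1 : R) (fun t : R => t *: w) w.
  apply: DeriveDef; first exact/derivable1_diffP.
  by rewrite deriveE // diff_val scale1r.
rewrite -[X in is_derive _ _ _ X]add0r; exact: is_deriveD.
Qed.

Lemma derive1_line (u w : 'rV[R]_m) (t : R) : derive1 (fun t => u + t *: w) t = w.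
Proof. by rewrite derive1E; have [_ ->] := is_derive_line u w t. Qed.

Lemma path_length_segment g a u v : atlas M a ->
  (forall t : R, 0 <= t <= 1 -> (a @` dom a) (u + t *: (v - u))) ->
  path_length g (param a u) (param a v)
    (\int[lebesgue_measure]_(t in `[0%R, 1%R]%classic)
       speed g a (fun t => u + t *: (v - u)) t).
Proof.
move=> Aa auv; pose c t := u + t *: (v - u).
have dc := is_derive_line u (v - u).
have := @PathCons R m M g a c (param a (c 1)) 0 Aa.
have -> : c 0 = u by rewrite /c scale0r addr0.
have -> : c 1 = v by rewrite /c scale1r addrC subrK.
rewrite addr0; apply.
- by move=> t; have [] := dc t.
- rewrite (_ : derive1 c = cst (v - u)); first by move=> t; exact: cvg_cst.
  by apply/funext => t; exact: derive1_line.
- by move=> t; rewrite in_itv; exact: auv.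
- exact: PathNil.
Qed.

(** The paths are straight segments in a ball of a chart at x on which the
    components of g are bounded. *)
Lemma near_path_length g (x : M) : smooth_tensor g -> exists D,
  \forall y \near x, \forall z \near x, exists2 L, path_length g y z L & L <= D.
Proof.
move=> sg; pose a := chart_at x; have Aa : atlas M a := chart_at_atlas x.
have ax : dom a x := dom_chart_at x.
pose K i j := `|tcoord a g (a x) i j| + 1.
have nKij i j : \forall u \near a x, `|tcoord a g u i j| <= K i j.
  have h := tcoord_continuous (i := i) (j := j) sg Aa (coord_img ax).
  by apply: (cvgr_le _ (cvg_norm h)); rewrite /K ltrDl.
have nK : \forall u \near a x, forall i j, `|tcoord a g u i j| <= K i j.
  exact: (@filter_forall2 _ (nbhs (a x)) _ _
    (fun i j u => `|tcoord a g u i j| <= K i j) _ nKij).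
have : \forall u \near a x, (a @` dom a) u /\ forall i j, `|tcoord a g u i j| <= K i j.
  exact: filterS2 (near_img ax) nK.
move=> /(nbhs_ballP (a x))[e /= e0 He].
pose S := \sum_i \sum_j K i j.
pose D := Num.sqrt (S * (m%:R * (2 * e) ^+ 2)).
have near_e : \forall y \near x, dom a y /\ ball (a x) e (a y).
  apply: filterI; first exact: near_dom.
  have ca : a @ x --> a x := Defs.coord_continuous ax.
  by have := ca _ (nbhsx_ballx (a x) e e0).
exists D; apply: filterS (near_e) => y [ay ey].
apply: filterS (near_e) => z [az ez].
have uv t : 0 <= t <= 1 -> ball (a x) e (a y + t *: (a z - a y)).
  move=> /andP[t0 t1]; move: ey ez; rewrite -!ball_normE /ball_ /= => ey ez.
  have -> : a x - (a y + t *: (a z - a y)) = (1 - t) *: (a x - a y) + t *: (a x - a z).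
    by rewrite !scalerBr !scalerBl !scale1r; apply/rowP => i; rewrite !mxE; ring.
  rewrite (le_lt_trans (ler_normD _ _)) // !normrZ (ger0_norm t0) ger0_norm ?subr_ge0 //.
  move: ey ez; set p := `|a x - a y|; set q := `|a x - a z| => py qz.
  apply: (@le_lt_trans _ _ (Num.max p q)); last by rewrite gt_max py.
  have pr : p <= Num.max p q by rewrite le_max lexx.
  have qr : q <= Num.max p q by rewrite le_max lexx orbT.
  move: pr qr; set r := Num.max p q; nra.
exists (\int[lebesgue_measure]_(t in `[0%R, 1%R]%classic)
       speed g a (fun t => a y + t *: (a z - a y)) t).
  rewrite -[y in path_length _ y](coordK ay) -[z in path_length _ _ z](coordK az).
  by apply: path_length_segment => // t /uv /He[].
have itv_img t : 0 <= t <= 1 -> (a @` dom a) (a y + t *: (a z - a y)).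
  by move=> /uv /He[].
apply: Rintegral_le_cst => t t01.
  apply: speed_cvg => //; last exact: itv_img.
    have dl : differentiable (fun t : R => a y + t *: (a z - a y)) t.
      by apply/derivable1_diffP; have [] := is_derive_line (a y) (a z - a y) t.
    by have := differentiable_continuous dl.
  rewrite (_ : derive1 _ = cst (a z - a y)); first exact: cvg_cst.
  by apply/funext => s; exact: derive1_line.
rewrite /speed derive1_line; apply: ler_wsqrtr.
rewrite (le_trans (ler_norm _)) // (le_trans (qf_bound _ _)) //.
apply: ler_pM; first by rewrite sumr_ge0 // => i _; rewrite sumr_ge0.
- exact: qf1_ge0.
- by apply: ler_sum => i _; apply: ler_sum => j _; have [_] := He _ (uv t t01).
rewrite qf1 mulr_natl -[X in _ *+ X]card_ord -sumr_const; apply: ler_sum => i _.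
rewrite -(real_normK (num_real ((a z - a y) 0 i))) ler_pXn2r // ?nnegrE ?mulr_ge0 ?(ltW e0) //.
apply: (le_trans (coord_le_norm _ _)).
rewrite -(subrK (a x) (a z)) -addrA (le_trans (ler_normD _ _)) //.
move: ey ez; rewrite -!ball_normE /ball_ /= => ey ez.
by rewrite mulr_natl mulr2n lerD // ltW // distrC.
Qed.

End Paths.

Section Distance.
Context {R : realType} {m : nat} {M : manifold R m}.
Context {g : M -> 'M[R]_m} (sg : smooth_tensor g) (cM : connected [set: M]).

(** The set of points that are joined to p is open and closed, since all points in
    a neighbourhood of any point are joined to each other. *)
Lemma exists_path p x : exists L, path_length g p x L.
Proof.
pose A : set M := [set x | exists L, path_length g p x L].
suff AT : A = [set: M] by have : A x by rewrite AT.
have near_path (y : M) : \forall x' \near y, \forall z \near y, exists L, path_length g x' z L.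
  have [D ] := near_path_length y sg; apply: filterS => x'; apply: filterS => z.
  by move=> [L]; exists L.
apply: cM.
- by exists p, 0; exact: PathNil.
- exists A°; first exact: open_interior.
  rewrite setTI; apply/seteqP; split=> [y [L pL]|]; last exact: interior_subset.
  have := nbhs_singleton (near_path y); apply: filterS => z [K yz].
  by exists (L + K); exact: path_length_trans pL yz.
- exists (closure A); first exact: closed_closure.
  rewrite setTI; apply/seteqP; split=> [|y cy]; first exact: subset_closure.
  have := near_path y => near_y.
  have [z [[L pz] zy]] := cy _ near_y.
  have [K zyK] := nbhs_singleton zy.
  by exists (L + K); exact: path_length_trans pz zyK.
Qed.

Lemma distance_le_length p x L : path_length g p x L -> distance g p x <= L.
Proof.
move=> pL; apply: ge_inf => //.
by exists 0 => K; exact: path_length_ge0.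
Qed.

Lemma compact_distance_bounded p (K : set M) : compact K ->
  exists D, forall x, K x -> distance g p x <= D.
Proof.
move=> /compact_near_coveringP/(_ R +oo%R (fun D x => distance g p x <= D) _) H.
have : \forall D \near +oo%R, K `<=` (fun x => distance g p x <= D).
  apply: H => x _; have [L px] := exists_path p x.
  have [D near_x] := near_path_length x sg.
  have near_x' := nbhs_singleton near_x.
  exists ([set y | exists2 k, path_length g x y k & k <= D],
    [set B | L + D <= B]) => [|[y B] [/= [k xy kD] LB]] /=.
    by split; [exact: near_x'|apply: nbhs_pinfty_ge; exact: num_real].
  apply: le_trans (distance_le_length (path_length_trans px xy)) _.
  by rewrite (le_trans _ LB) // lerD2l.
by move=> [D [_ HD]]; exists (D + 1) => x; apply: HD; rewrite ltrDl.
Qed.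

End Distance.

(** * The radial coordinate and the distance function *)

Section ConeCompactness.
Context {R : realType} {m : nat} {N : manifold R m.+1} (C : cone N).

Lemma Some_continuous : continuous (Some : N -> cone_space C).
Proof.
move=> y U; rewrite nbhsE => -[V [[oV _] Vy] VU].
have : nbhs y (Some @^-1` V) by apply: open_nbhs_nbhs.
by apply: filterS => z /VU.
Qed.

Lemma annulus_compact (a b : R) : 0 < a ->
  compact (cone_pt C @` (`[a, b]%classic `*` [set: link C])).
Proof.
move=> a0; apply: continuous_compact; last first.
  by apply: compact_setX; [exact: segment_compact|exact: link_compact].
apply: continuous_in_subspaceT => -[t s]; rewrite inE => -[/= + _].
rewrite in_itv /= => /andP[at_ _]; apply: cone_pt_continuous.
exact: lt_le_trans at_.
Qed.

Lemma in_annulus (a b : R) y : a <= cone_r C y <= b ->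
  (cone_pt C @` (`[a, b]%classic `*` [set: link C])) y.
Proof.
by move=> yab; exists (cone_r C y, cone_link C y); [split|exact: cone_ptK].
Qed.

(** An open set around the apex contains the points with r < e for some e > 0, and
    what remains of the ball is a compact annulus. *)
Lemma cone_ball_compact (b : R) :
  compact ([set w | if w is Some y then cone_r C y <= b else True] : set (cone_space C)).
Proof.
apply/compact_near_coveringP => T F P FF H.
have [[U V] /= [U0 FV] UV] := H None I.
have [e e0 eU] : exists2 e : R, 0 < e & forall y, cone_r C y < e -> U (Some y).
  move: U0; rewrite nbhsE => -[W [[_ oW] W0 WU]].
  by have [e e0 eW] := oW W0; exists e => // y /eW /WU.
pose K : set (cone_space C) := Some @` (cone_pt C @` (`[e, b]%classic `*` [set: link C])).
have cK : compact K.
  apply: continuous_compact; last exact: annulus_compact.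
  by apply: continuous_subspaceT; exact: Some_continuous.
have nK : \forall i \near F, K `<=` P i.
  have /compact_near_coveringP cov := cK; apply: cov => w [_ [[t s] /= [ts _] <-] <-].
  move: ts; rewrite in_itv /= => /andP[et tb]; apply: H.
  by rewrite /= cone_rK // (lt_le_trans e0).
apply: filterS2 nK FV => i KP Vi [y|] /= yb; last first.
  by apply: (UV (None, i)); split=> //=; exact: nbhs_singleton U0.
have [/eU Uy|ey] := ltP (cone_r C y) e; first exact: (UV (Some y, i)).
by apply: KP; exists y => //; apply: in_annulus; rewrite ey.
Qed.

End ConeCompactness.

Section Exhaustion.
Context {R : realType} {m : nat} {M N : manifold R m.+1} {C : cone N}.
Context { pi : M -> cone_space C} {psi : N -> M} (rs : cone_resolution pi psi).
Context {g : M -> 'M[R]_m.+1} (rg : riemannian g) (cM : connected [set: M]).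

Let sg : smooth_tensor g. Proof. by case: rg. Qed.

(** The value 0 on the exceptional set makes this function continuous and, as pi
    is proper, proper. *)
Definition radius (x : M) : R := oapp (cone_r C) 0 (pi x).

Lemma radius_ge0 x : 0 <= radius x.
Proof. by rewrite /radius; case: (pi x) => //= y; exact/ltW/cone_r_gt0. Qed.

Lemma radius_gt0 x : 0 < radius x -> exists y, pi x = Some y.
Proof. by rewrite /radius; case: (pi x) => [y|]; [exists y|rewrite ltxx]. Qed.

Lemma radius_continuous : continuous radius.
Proof.
move=> x; case pxy : (pi x) => [y|].
  have rE : {near x, cone_r C \o cone_proj pi y =1 radius}.
    have := near_off_exceptional rs pxy; apply: filterS => x' [y' px'].
    by rewrite /radius /cone_proj /= px'.
  have [[cq _] _] := cone_proj_mdiff rs y pxy.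
  have qx : cone_proj pi y x = y by rewrite /cone_proj pxy.
  have c1 : cone_r C @ cone_proj pi y x --> cone_r C (cone_proj pi y x).
    exact: cone_r_continuous.
  have c2 : cone_r C \o cone_proj pi y @ x --> radius x.
    by rewrite /radius pxy /= -[in X in _ --> X]qx; exact: (cvg_comp _ _ cq c1).
  by apply: cvg_trans c2; exact: near_eq_cvg.
rewrite /continuous_at {2}/radius pxy /=; apply/cvgrPdist_lt => e e0.
pose U : set (cone_space C) := [set w | if w is Some z then cone_r C z < e else True].
have oU : open U.
  split; last by move=> _; exists e.
  rewrite (_ : _ @^-1` _ = cone_r C @^-1` [set r | r < e]); last by [].
  by apply: open_comp; [move=> z _; exact: cone_r_continuous|exact: open_lt].
have nU : nbhs (pi x) U by apply: open_nbhs_nbhs; split=> //; rewrite pxy.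
have : \forall x' \near x, U (pi x') by exact: cr_continuous rs _ _ nU.
apply: filterS => x'.
rewrite sub0r normrN ger0_norm ?radius_ge0 // /radius.
by case: (pi x').
Qed.

Lemma radius_sublevel_compact b : compact [set x | radius x <= b].
Proof.
have [b0|b0] := leP 0 b; last first.
  rewrite (_ : mkset _ = set0); first exact: compact0.
  apply/seteqP; split=> // x /= xb.
  by have := le_lt_trans xb b0; rewrite ltNge radius_ge0.
rewrite (_ : mkset _ = pi @^-1` [set w | if w is Some y then cone_r C y <= b else True]).
  by apply: (cr_proper rs); exact: cone_ball_compact.
by apply/seteqP; split=> x; rewrite /= /radius; case: (pi x).
Qed.

(** Far from p implies far out on the cone: distance g p is bounded on the compact
    sublevel sets of the radius. *)
Lemma radius_large p b : exists D, forall x, D < distance g p x -> b < radius x.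
Proof.
have [D HD] := compact_distance_bounded sg cM p (radius_sublevel_compact (b := b)).
exists D => x; rewrite !ltNge; apply: contra => xb; exact: HD.
Qed.

End Exhaustion.
Arguments radius {R m M N C} pi x.

Lemma le_twice_sqrt (R : realType) (r q : R) : r ^+ 2 <= 4 * q -> r <= 2 * Num.sqrt q.
Proof.
move=> rq; have q0 : 0 <= q.
  by rewrite -(pmulr_rge0 _ (_ : 0 < 4 :> R)) //; apply: le_trans rq; exact: sqr_ge0.
have -> : 2 * Num.sqrt q = Num.sqrt (4 * q).
  rewrite sqrtrM // (_ : 4 = 2 ^+ 2 :> R); last by rewrite -natrX.
  by rewrite sqrtr_sqr ger0_norm.
by apply: le_trans (ler_norm _) _; rewrite -sqrtr_sqr ler_wsqrtr.
Qed.

Section DistanceGrowth.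
Context {R : realType} {m : nat} {M N : manifold R m.+1} {C : cone N}.
Context { pi : M -> cone_space C} {psi : N -> M} (rs : cone_resolution pi psi).
Context {g : M -> 'M[R]_m.+1} (sg : smooth_tensor g).
Implicit Types (x : M) (a : chart R M m.+1) (c : R -> 'rV[R]_m.+1).

Context {r1 : R} (r1_ge0 : 0 <= r1) (dr_bound : dominates_dr C (pullback psi g) r1).

(** If u is the velocity of the projection of the path to the cone, the derivative
    of the radius is dr(u) and the squared speed is (psi^* g)(u, u). *)
Lemma derive_radius_le a c (t : R) : atlas M a -> derivable c t 1 ->
  (a @` dom a) (c t) -> r1 < radius pi (param a (c t)) ->
  derivable (fun s => radius pi (param a (c s))) t 1 /\
  (fun s => radius pi (param a (c s)))^`()%classic t <= 2 * speed g a c t.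
Proof.
move=> Aa dc act rt; have [x xE] : exists x, (param a \o c) t = x by eexists.
rewrite [param a (c t)]xE in rt.
have ax : dom a x by rewrite -xE; exact: param_dom.
have acx : a x = c t by rewrite -xE; exact: paramK.
have [y pxy] : exists y, pi x = Some y.
  by apply: radius_gt0; exact: le_lt_trans rt.
pose b := chart_at x; have bx : dom b x := dom_chart_at x.
have dcd : differentiable c t by exact/derivable1_diffP.
have ct : c @ t --> c t := differentiable_continuous dcd.
have pc : param a \o c @ t --> param a (c t).
  by apply: cvg_comp ct _; exact: param_continuous.
have dba : differentiable (b \o param a) (c t).
  by rewrite -acx; apply: differentiable_transition => //; exact: chart_at_atlas.
have dbc : differentiable (b \o (param a \o c)) t := differentiable_comp dcd dba.
have w_def : 'd (b \o (param a \o c)) t 1 = derive1 c t *m frame a x.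
  have e1 := congr1 (fun d : R -> 'rV_m.+1 => d 1) (diff_comp dcd dba).
  by rewrite [LHS]e1 /= -derive1E' // -jacobianE -acx.
have dq := cone_proj_mdiff rs y pxy; have [dqx qJ] := dq.
have qx : cone_proj pi y x = y by rewrite /cone_proj pxy.
have dr : fdifferentiable (cone_r C) (cone_proj pi y x) by exact: cone_r_diff.
have [d1 d2] := mdiff_fcomp dqx dr.
have := @diff_through_chart _ _ _ _ _ b (param a \o c) (cone_r C \o cone_proj pi y) t pc.
rewrite xE => /(_ bx dbc d1)[d3 d4].
have E : {near t, (cone_r C \o cone_proj pi y) \o (param a \o c) =1
                  fun s => radius pi (param a (c s))}.
  have : \forall s \near t, exists y', pi (param a (c s)) = Some y'.
    have pc' : param a \o c @ t --> x by rewrite -xE.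
    by have := pc' _ (near_off_exceptional rs pxy).
  by apply: filterS => s [y' ps]; rewrite /radius /cone_proj /= ps.
have [d5 d6] := near_eq_differentiable E d3.
split; first exact/derivable1_diffP.
pose w := derive1 c t *m frame a x.
pose u := w *m mdiff (cone_proj pi y) x.
have uw : u = w *m mdiff (cone_proj pi y) x := erefl u.
clearbody u.
have uE : w = u *m mdiff psi y.
  have := mdiff_inverse dqx (cr_inv_diff rs _) (near_psi_proj rs y pxy).
  rewrite qx => qpsi; rewrite uw -mulmxA qpsi.
  exact: esym (mulmx1 w).
have fE : (fun s => radius pi (param a (c s)))^`()%classic t = cone_dr C y u.
  have e6 := congr1 (fun d : R -> R => d 1) d6.
  have e4 := congr1 (fun d : R -> R => d 1) d4.
  have e2 := congr1 (fun d : 'rV_m.+1 -> R => d w) d2.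
  apply: (etrans (derive1E' d5)); apply: (etrans e6); apply: (etrans e4).
  rewrite [X in 'd _ _ X = _]w_def -/w. move: e2 => /= e2. apply: (etrans e2).
  have uJ : 'd (chart_at (cone_proj pi y x) \o cone_proj pi y \o param (chart_at x))
      (chart_at x x) w = u.
    by rewrite uw /mdiff; exact/esym/jacobianE.
  by rewrite /= uJ qx.
have sE : qf (tcoord a g (c t)) (derive1 c t) = qf (pullback psi g y) u.
  have s1 : qf (tcoord a g (c t)) (derive1 c t) = qf (g x) w.
    by rewrite -acx (tcoordE g ax) qf_congr.
  have s2 : qf (pullback psi g y) u = qf (g (psi y)) (u *m mdiff psi y).
    exact: qf_congr (mdiff psi y) (g (psi y)) u.
  have s3 : qf (g (psi y)) (u *m mdiff psi y) = qf (g x) w.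
    rewrite (cr_mapK rs pxy) -uE; reflexivity.
  exact: (etrans s1 (esym (etrans s2 s3))).
have ry : r1 < cone_r C y by move: rt; rewrite /radius pxy.
rewrite fE /speed sE; exact: le_twice_sqrt (dr_bound ry u).
Qed.

(** The maximum with r1 is needed since the radius is not controlled below r1. *)
Lemma radius_path_length x z L : path_length g x z L ->
  radius pi z <= Num.max (radius pi x) r1 + 2 * L.
Proof.
elim=> [w|a c w l Aa dc cdc ac _ IH]; first by rewrite mulr0 addr0 le_max lexx.
set B := Num.max _ r1.
have act (t : R) : 0 <= t <= 1 -> (a @` dom a) (c t).
  by move=> t01; apply: ac; rewrite in_itv.
have ct (t : R) : c @ t --> c t.
  by apply: differentiable_continuous; exact/derivable1_diffP.
have r1B : radius pi (param a (c 1)) <=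
    B + 2 * \int[lebesgue_measure]_(t in `[0%R, 1%R]%classic) speed g a c t.
  apply: (growth_above_threshold (f := fun t => radius pi (param a (c t)))).
  - move=> t t01; have pc : param a \o c @ t --> param a (c t).
      by apply: cvg_comp (ct t) _; exact: param_continuous (act t t01).
    have rc : radius pi @ param a (c t) --> radius pi (param a (c t)).
      exact: radius_continuous rs _.
    by have := cvg_comp _ _ pc rc.
  - by move=> t t01; apply: speed_cvg => //; [exact: cdc|exact: act].
  - exact: speed_ge0.
  - by rewrite /B le_max lexx.
  move=> t t01; rewrite /B gt_max => /andP[_ rt].
  by apply: derive_radius_le => //; exact: act.
rewrite -/(speed g a c) in r1B *.
apply: le_trans IH _.
rewrite mulrDr addrA lerD2r ge_max r1B /=.
apply: (@le_trans _ _ B); first by rewrite /B le_max lexx orbT.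
by rewrite lerDl mulr_ge0 // Rintegral_ge0 // => t _; exact: speed_ge0.
Qed.

(** Far out on the cone implies far from p. A path from p exists, so distance is an
    infimum over a nonempty set. *)
Lemma distance_large (cM : connected [set: M]) p D :
  exists b, forall x, b < radius pi x -> D < distance g p x.
Proof.
exists (Num.max (radius pi p) r1 + 2 * D) => x bx.
pose d := (radius pi x - Num.max (radius pi p) r1) / 2.
apply: (@lt_le_trans _ _ d).
  by rewrite /d ltr_pdivlMr // mulrC ltrBrDl.
apply: lb_le_inf; first by have [L pL] := exists_path sg cM p x; exists L.
move=> L /radius_path_length rL.
by rewrite /d ler_pdivrMr // mulrC lerBlDl.
Qed.

End DistanceGrowth.

Section AsymptoticCone.
Context {R : realType} {m : nat} {N : manifold R m.+1} (C : cone N).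

Lemma diff_fdiff (f : N -> R) y (u : 'rV[R]_m.+1) : fdifferentiable f y ->
  (u *m (fdiff f y)^T) 0 0 = 'd (f \o param (chart_at y)) (chart_at y y) u.
Proof.
move=> df; rewrite mxE [in RHS](row_sum_delta u) linear_sum /=; apply: eq_bigr => i _.
by rewrite linearZ /= !mxE /partial deriveE.
Qed.

(** dr^2 is one of the two nonnegative summands of the cone metric. *)
Lemma cone_metric_ge y u :
  cone_dr C y u ^+ 2 <= qf (cone_metric C y) u.
Proof.
rewrite /cone_metric qfD qfZ.
have -> : qf ((fdiff (cone_r C) y)^T *m fdiff (cone_r C) y) u =
    cone_dr C y u ^+ 2.
  rewrite /cone_dr -(diff_fdiff _ (cone_r_diff C y)) /qf !mulmxA.
  rewrite -{2}[fdiff _ _]trmxK -mulmxA -trmx_mul mxE big_ord1 expr2.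
  by rewrite [X in _ * X = _]mxE.
rewrite lerDl mulr_ge0 ?sqr_ge0 //.
have -> : qf (pullback (cone_link C) (link_metric C) y) u =
    qf (link_metric C (cone_link C y)) (u *m mdiff (cone_link C) y).
  exact: qf_congr (mdiff (cone_link C) y) _ u.
apply: pos_form_nonneg; have [_ _ pl] := link_riemannian C.
by move=> v /(pl (cone_link C y)).
Qed.

(** Far out, the difference between k and the cone metric gC is at most half of gC,
    so 2 k >= gC >= dr^2. *)
Lemma asymptotic_dr_bound (k gC : N -> 'M[R]_m.+1) (A r0 : R) :
  gC = cone_metric C -> (forall y, (gC y)^T = gC y) -> (forall y, pos_form (gC y)) ->
  (forall y, r0 < cone_r C y ->
    nabla_norm gC (fun z => k z - gC z) 0 y <= A * cone_r C y ^- 2) ->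
  exists2 r1, 0 <= r1 & dominates_dr C k r1.
Proof.
move=> gCE sC pC HA; pose c : R := m.+1%:R * m.+1%:R.
have c0 : 0 <= c by rewrite mulr_ge0.
(* For r >= b, which is at least 1, c |A| r^-2 <= c |A| / r <= 1 / 2. *)
pose b := 1 + 2 * (c * `|A|).
have b1 : 1 <= b by rewrite lerDl !mulr_ge0.
exists (Num.max r0 b); first by rewrite le_max (le_trans ler01 b1) orbT.
move=> y; rewrite gt_max => /andP[/HA nA br] u.
set r := cone_r C y in nA br; have r_gt0 : 0 < r by exact: cone_r_gt0.
have := cone_metric_ge y u; rewrite -gCE; set d := _ ^+ 2; set G := qf _ u => dG.
have G0 : 0 <= G by exact: pos_form_nonneg.
have B := @tensor_norm2_bound _ _ (tcoord (chart_at y) gC)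
  (tcoord (chart_at y) (fun z => k z - gC z)) (chart_at y y) u.
rewrite !tcoord_chart_at -/G in B.
have {B} := B (sC y) (pC y).
have -> : qf (k y - gC y) u = qf (k y) u - G by rewrite qfD qfN.
set T := tensor_norm _ _ _ _ => B.
have TA : T <= A * r ^- 2 by exact: nA.
have cT : c * T <= 1 / 2.
  apply: (@le_trans _ _ (c * `|A| * r^-1 ^+ 2)).
    rewrite -mulrA ler_wpM2l // (le_trans TA) // exprVn.
    by rewrite ler_wpM2r ?ler_norm // invr_ge0 exprn_ge0 // ltW.
  have cb : c * `|A| <= 1 / 2 * r ^+ 2.
    have : 0 <= c * `|A| by rewrite mulr_ge0.
    move: br; rewrite /b; set q := c * `|A| => br q0.
    have : r <= r ^+ 2 by rewrite ler_eXnr // ltW //; lra.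
    lra.
  rewrite exprVn ler_pdivrMr ?exprn_gt0 //.
move: B; rewrite ler_norml => /andP[B _].
have : c * T * G <= 1 / 2 * G by rewrite ler_wpM2r.
move: B; rewrite -/c; move: dG G0; set K := qf (k y) u; lra.
Qed.

End AsymptoticCone.

(** * Comparison at infinity and comparison of the cones *)

Section LocalConvergence.
Context {R : realType} {m : nat} {N : manifold R m.+1}.
Implicit Types (h k : N -> 'M[R]_m.+1) (H K : R -> N -> 'M[R]_m.+1).

(** Uniform convergence on a compact ball of the chart at y0, together with the
    continuity of the limit at y0. *)
Lemma locally_smooth_cvg_near H h y0 (e : R) : smooth_tensor h ->
  locally_smooth_cvg H h -> 0 < e ->
  \forall y \near y0 & t \near 0^'+, dom (chart_at y0) y /\
    forall i j, `|tcoord (chart_at y0) (H t) (chart_at y0 y) i j - h y0 i j| <= e.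
Proof.
move=> sh cH e0; pose a := chart_at y0; have Aa : atlas N a := chart_at_atlas y0.
have ay0 : dom a y0 := dom_chart_at y0.
have e20 : 0 < e / 2 by rewrite divr_gt0.
have [r rK] := (nbhs_closedballP (a @` dom a) (a y0)).1 (near_img ay0).
pose B := closed_ball (a y0) r%:num.
have cB : compact B.
  apply: bounded_closed_compact; last exact: closed_ball_closed.
  rewrite /B closed_ballE //; exists (`|a y0| + r%:num); split; first exact: num_real.
  move=> M rM u /= ur; rewrite -(subrK (a y0) u) (le_trans (ler_normD _ _)) //.
  by rewrite addrC (le_trans _ (ltW rM)) // lerD2l distrC.
have near_t : \forall t \near 0^'+, forall i j, forall u, B u ->
    `|tcoord a (H t) u i j - tcoord a h u i j| < e / 2.
  apply: (@filter_forall2 _ _ _ _ (fun i j t => forall u, B u ->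
    `|tcoord a (H t) u i j - tcoord a h u i j| < e / 2)) => i j.
  exact: (cH a B [::] i j Aa cB rK).
have near_ij i j : \forall y \near y0, `|tcoord a h (a y) i j - h y0 i j| <= e / 2.
  have c1 := tcoord_continuous (i := i) (j := j) sh Aa (coord_img ay0).
  have c2 : a @ y0 --> a y0 := Defs.coord_continuous ay0.
  have c3 : (fun y => tcoord a h (a y) i j) @ y0 --> h y0 i j.
    rewrite -(tcoord_chart_at h y0); exact: (cvg_comp _ _ c2 c1).
  have /cvgrPdist_le/(_ _ e20) := c3.
  by apply: filterS => y; rewrite distrC.
have near_y : \forall y \near y0, forall i j, `|tcoord a h (a y) i j - h y0 i j| <= e / 2.
  exact: (@filter_forall2 _ _ _ _ (fun i j y => `|tcoord a h (a y) i j - h y0 i j| <= e / 2)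
    _ near_ij).
have near_B : \forall y \near y0, B (a y).
  have c2 : a @ y0 --> a y0 := Defs.coord_continuous ay0.
  have nB : nbhs (a y0) B by apply/nbhs_closedballP; exists r.
  have pull (P : set 'rV[R]_m.+1) : nbhs (a y0) P -> \forall y \near y0, P (a y).
    by move=> nP; have := c2 _ nP.
  exact: pull nB.
exists ([set y | [/\ dom a y, B (a y) & forall i j, `|tcoord a h (a y) i j - h y0 i j| <= e / 2]],
  [set t | forall i j, forall u, B u -> `|tcoord a (H t) u i j - tcoord a h u i j| < e / 2]).
  by split=> //=; apply: filterS3 (near_dom ay0) near_B near_y.
move=> [y t] [/= [ay By hy] Ht]; split=> // i j.
rewrite -(subrK (tcoord a h (a y) i j) (tcoord _ (H t) _ i j)) -addrA.
rewrite (le_trans (ler_normD _ _)) // [leRHS]splitr lerD //.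
exact/ltW/Ht.
Qed.

Lemma locally_smooth_cvg_pt H h y v : smooth_tensor h -> locally_smooth_cvg H h ->
  (fun t => qf (H t y) v) @ 0^'+ --> qf (h y) v.
Proof.
move=> sh cH; have hij i j : (fun t => H t y i j) @ 0^'+ --> h y i j.
  apply/cvgrPdist_le => e e0.
  have [[U V] /= [Uy VF] UV] := locally_smooth_cvg_near y sh cH e0.
  apply: filterS VF => t Vt; rewrite distrC.
  have [_ /(_ i j)] := UV (y, t) (conj (nbhs_singleton Uy) Vt).
  by rewrite /= tcoord_chart_at.
rewrite qfE (_ : (fun t => _) = fun t => \sum_i \sum_j v 0 i * H t y i j * v 0 j); last first.
  by apply/funext => t; rewrite qfE.
apply: cvg_big => [|i _]; first exact: add_continuous.
apply: cvg_big => [|j _]; first exact: add_continuous.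
exact: cvgM (cvgM (cvg_cst (v 0 i)) (hij i j)) (cvg_cst (v 0 j)).
Qed.

(** As s < s', the form expR s' *: k - h is positive definite at y0, which is an
    open condition. *)
Lemma near_form_le H K h k (s s' : R) y0 : riemannian h -> riemannian k ->
  locally_smooth_cvg H h -> locally_smooth_cvg K k ->
  s < s' -> form_le (h y0) (expR s *: k y0) ->
  \forall y \near y0 & t \near 0^'+, form_le (H t y) (expR s' *: K t y).
Proof.
move=> [sh symh _] [sk symk pk] cH cK ss' hk.
pose A := expR s' *: k y0 - h y0.
have symA : A^T = A by rewrite /A linearB linearZ /= symh symk.
have pA : pos_form A.
  move=> v v0; have pv : 0 < qf (k y0) v by exact: pk.
  have := hk v; rewrite -!/(qf _ _) qfZ => hv; rewrite /A qfD qfN qfZ subr_gt0.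
  by rewrite (le_lt_trans hv) // ltr_pM2r // ltr_expR.
have [e e0 eA] := pos_form_near symA pA.
pose d := e / (expR s' + 1).
have s1 : 0 < expR s' + 1 by rewrite ltr_wpDl ?expR_ge0.
have d0 : 0 < d by rewrite divr_gt0.
have nH := locally_smooth_cvg_near y0 sh cH d0.
have nK := locally_smooth_cvg_near y0 sk cK d0.
have Aa := chart_at_atlas y0.
move: nH nK => [[U V] /= [Uy FV] UV] [[U' V'] /= [Uy' FV'] UV'].
exists (U `&` U', V `&` V'); first by split; exact: filterI.
move=> [y t] [/= [Uy1 Uy2] [Vt1 Vt2]].
have [ay Hyt] := UV (y, t) (conj Uy1 Vt1); have [_ Kyt] := UV' (y, t) (conj Uy2 Vt2).
apply/(form_le_congr _ _ (unitmx_frame Aa ay)).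
set Q := frame _ _.
have -> : Q *m (expR s' *: K t y) *m Q^T = expR s' *: (Q *m K t y *m Q^T).
  by rewrite -scalemxAr -scalemxAl.
have := eA (expR s' *: (Q *m K t y *m Q^T) - Q *m H t y *m Q^T) => nonneg v.
rewrite -!/(qf _ _) -subr_ge0 -qfN -qfD; apply: nonneg => i j.
have := Hyt i j; have := Kyt i j; rewrite !(tcoordE _ ay) -/Q => kx hx.
have E (Y1 Y2 K1 H1 : 'M[R]_m.+1) c : (c *: Y1 - Y2) i j - (c *: K1 - H1) i j =
    c * (Y1 i j - K1 i j) - (Y2 i j - H1 i j) by rewrite !mxE; ring.
rewrite E (le_trans (ler_normB _ _)) // normrM (ger0_norm (expR_ge0 s')).
apply: (@le_trans _ _ (expR s' * d + d)).
  by rewrite lerD // ler_wpM2l // expR_ge0.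
by rewrite -[X in _ + X]mul1r -mulrDl /d mulrC divfK // gt_eqF.
Qed.

End LocalConvergence.

Lemma riemannian_nonneg (R : realType) m (M : manifold R m) (h : M -> 'M[R]_m) :
  riemannian h -> nonneg_tensor h.
Proof. by move=> [_ _ ph] x; apply: pos_form_nonneg => v v0; exact: ph. Qed.

Section Comparison.
Context {R : realType} {m : nat} {M N : manifold R m.+1} {C : cone N}.
Context { pi : M -> cone_space C} {psi : N -> M} (rs : cone_resolution pi psi).
Context {X : M -> 'rV[R]_m.+1} {Phi : R -> M -> M}.
Context (X_radial : lifts_radial pi X) (flow : expander_flow X Phi).
Context {g : M -> 'M[R]_m.+1} (rg : riemannian g) (cM : connected [set: M]).
Context {r1 : R} (r1_ge0 : 0 <= r1) (dr_bound : dominates_dr C (pullback psi g) r1).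
Context (p : M).

Definition evolve (G : M -> 'M[R]_m.+1) (t : R) : N -> 'M[R]_m.+1 :=
  pullback psi (fun x => t *: pullback (Phi t) G x).

(** Comparison of forms is invariant under a common congruence and a common
    scaling. *)
Lemma close_evolve s G1 G2 y (t : R) : 0 < t ->
  close_forms s (evolve G1 t y) (evolve G2 t y) <->
  close_forms s (G1 (Phi t (psi y))) (G2 (Phi t (psi y))).
Proof.
move=> t0; have [Q uQ QE] := self_similar_congr rs X_radial flow y t0.
rewrite /evolve (QE G1) (QE G2).
by apply: iff_trans (close_formsZ _ _ _ t0) _; exact: close_forms_congr.
Qed.

Lemma radius_flow y (t : R) : 0 < t ->
  radius pi (Phi t (psi y)) = cone_r C y / Num.sqrt t.
Proof.
move=> t0; rewrite (flow_dilation rs X_radial flow) // /radius (cr_invK rs) /= cone_rK //.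
by rewrite divr_gt0 ?sqrtr_gt0 ?cone_r_gt0.
Qed.

(** The radius of Phi_t(psi y) is r(y) t^(-1/2), which tends to infinity. *)
Lemma flow_to_infinity (A : set M) y : at_infinity g p A ->
  \forall t \near 0^'+, A (Phi t (psi y)).
Proof.
have [sg _ _] := rg.
move=> [D DA]; have [b bD] := distance_large rs sg r1_ge0 dr_bound cM p D.
pose c := `|b| + 1; have c0 : 0 < c by rewrite ltr_wpDl.
have r0 := cone_r_gt0 C y.
have d0 : 0 < (cone_r C y / c) ^+ 2 by rewrite exprn_gt0 // divr_gt0.
apply: filterS2 (nbhs_right_gt 0) (nbhs_right_lt d0) => t t0 td.
apply: DA; apply: bD; rewrite radius_flow //.
have st : 0 < Num.sqrt t by rewrite sqrtr_gt0.
rewrite ltr_pdivlMr //; apply: (@le_lt_trans _ _ (c * Num.sqrt t)).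
  by rewrite ler_pM2r // (le_trans (ler_norm b)) // lerDl.
rewrite -ltr_pdivlMl // mulrC.
have rc0 : 0 <= cone_r C y / c by rewrite divr_ge0 // ltW.
by rewrite -(@ltr_pXn2r _ 2 _ (Num.sqrt t)) ?nnegrE ?(ltW st) // sqr_sqrtr // ltW.
Qed.

Lemma at_infinity_nonempty (A : set M) (y : N) : at_infinity g p A -> A !=set0.
Proof.
move=> /(flow_to_infinity y) nA.
have [t At] := @filter_ex R 0^'+ (at_right_proper_filter 0) _ nA.
by exists (Phi t (psi y)).
Qed.

Context {G1 G2 : M -> 'M[R]_m.+1} {h1 h2 : N -> 'M[R]_m.+1}.
Context (rG1 : riemannian G1) (rG2 : riemannian G2).
Context (rh1 : riemannian h1) (rh2 : riemannian h2).
Context (cvg1 : locally_smooth_cvg (evolve G1) h1) (cvg2 : locally_smooth_cvg (evolve G2) h2).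

(** At a fixed point y, the bound at Phi_t(psi y) passes to the limit t --> 0. *)
Lemma close_cone s : at_infinity g p [set x | close_forms s (G1 x) (G2 x)] ->
  forall y, close_forms s (h1 y) (h2 y).
Proof.
move=> clos y; have near_c := flow_to_infinity y clos.
have [sh1 _ _] := rh1; have [sh2 _ _] := rh2.
have near_e : \forall t \near 0^'+, close_forms s (evolve G1 t y) (evolve G2 t y).
  by apply: filterS2 (nbhs_right_gt 0) near_c => t t0 ct; exact/close_evolve.
split=> v; rewrite -!/(qf _ _) qfZ.
  apply: (ler_cvg_to (locally_smooth_cvg_pt (y := y) (v := v) sh2 cvg2)
    (cvgM (cvg_cst (expR s)) (locally_smooth_cvg_pt (y := y) (v := v) sh1 cvg1))).
  by apply: filterS near_e => t [/(_ v) + _]; rewrite -!/(qf _ _) qfZ.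
apply: (ler_cvg_to (locally_smooth_cvg_pt (y := y) (v := v) sh1 cvg1)
  (cvgM (cvg_cst (expR s)) (locally_smooth_cvg_pt (y := y) (v := v) sh2 cvg2))).
by apply: filterS near_e => t [_ /(_ v)]; rewrite -!/(qf _ _) qfZ.
Qed.

(** The bound holds on the compact link r = 1 for all small times, and the flow
    carries the link at time t onto the set r = t^(-1/2). *)
Lemma close_at_infinity s s' : s < s' -> (forall y, close_forms s (h1 y) (h2 y)) ->
  at_infinity g p [set x | close_forms s' (G1 x) (G2 x)].
Proof.
move=> ss' clos; pose K := cone_pt C @` (`[1%R, 1%R]%classic `*` [set: link C]).
have cK : compact K by exact: annulus_compact.
have near_K : \forall t \near 0^'+,
    K `<=` (fun y => close_forms s' (evolve G1 t y) (evolve G2 t y)).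
  have /compact_near_coveringP cov := cK.
  apply: (cov R 0^'+ (fun t y => close_forms s' (evolve G1 t y) (evolve G2 t y)) _) => y _.
  have [c1 c2] := clos y.
  have [[U V] /= [Uy FV] UV] := near_form_le rh1 rh2 cvg1 cvg2 ss' c2.
  have [[U' V'] /= [Uy' FV'] UV'] := near_form_le rh2 rh1 cvg2 cvg1 ss' c1.
  exists (U `&` U', V `&` V'); first by split; exact: filterI.
  move=> [y' t] [/= [u1 u2] [v1 v2]]; split.
    by apply: (UV' (y', t)); split.
  by apply: (UV (y', t)); split.
have [e /= e0 He] := near_K.
have [D HD] := radius_large rs rg cM p (1 + e^-1).
exists D => x /HD rx.
have [y pxy] : exists y, pi x = Some y.
  by apply: radius_gt0; apply: lt_trans rx; rewrite addr_gt0 // invr_gt0.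
have ry : 1 + e^-1 < cone_r C y by move: rx; rewrite /radius pxy.
set r := cone_r C y in ry; have r0 : 0 < r by exact: cone_r_gt0.
have ie0 : 0 < e^-1 by rewrite invr_gt0.
have r_gt1 : 1 < r by apply: lt_trans ry; rewrite ltrDl.
(* The time at which the dilation by t^(-1/2) carries r = 1 to the radius of x. *)
pose t := (r ^+ 2)^-1; have t0 : 0 < t by rewrite invr_gt0 exprn_gt0.
have te : t < e.
  rewrite /t -[e]invrK ltf_pV2 ?posrE ?exprn_gt0 //.
  apply: (@lt_trans _ _ r); last by rewrite expr2 ltr_pMr.
  by apply: lt_trans ry; rewrite ltrDr.
pose z := cone_pt C (1, cone_link C y).
have Phi_z : Phi t (psi z) = x.
  rewrite (flow_dilation rs X_radial flow) // -(cr_mapK rs pxy).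
  rewrite /z cone_rK // cone_linkK // -[y in RHS](cone_ptK C) -/r.
  by rewrite /t sqrtrV ?sqr_ge0 // sqrtr_sqr (gtr0_norm r0) invrK mul1r.
have Kz : K z by exists (1, cone_link C y) => //; split=> //=; rewrite in_itv /= !lexx.
have := He t _ t0 z Kz; rewrite /ball_ /= sub0r normrN gtr0_norm // => /(_ te).
by move/(close_evolve _ _ _ _ t0); rewrite Phi_z.
Qed.

Lemma BL_inf_le s : 0 <= s -> at_infinity g p [set x | close_forms s (G1 x) (G2 x)] ->
  (BL_inf g p G1 G2 <= s%:E)%E.
Proof.
move=> s0 clos; apply: ge_ereal_inf.
exists (ereal_sup ((fun x => BL_pt (G1 x) (G2 x)) @` [set x | close_forms s (G1 x) (G2 x)])).
  by exists [set x | close_forms s (G1 x) (G2 x)].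
apply: ge_ereal_sup => _ [x clx <-].
by apply/BL_pt_le => //; exact: riemannian_nonneg.
Qed.

(** The two implications close_at_infinity and close_cone give the two
    inequalities. BL_sup is assumed finite in order to leave room above it for an
    arbitrarily small loss. *)
Lemma BL_inf_eq (y0 : N) : BL_sup h1 h2 \is a fin_num ->
  BL_inf g p G1 G2 = BL_sup h1 h2.
Proof.
move=> finb; have b0 : (0 <= BL_sup h1 h2)%E := BL_sup_ge0 h1 h2 y0.
have n1 := riemannian_nonneg rh1; have n2 := riemannian_nonneg rh2.
have m1 := riemannian_nonneg rG1; have m2 := riemannian_nonneg rG2.
move: finb b0; case bE : (BL_sup h1 h2) => [b| |] // _; rewrite lee_fin => b0.
apply/eqP; rewrite eq_le; apply/andP; split.
  apply/lee_addgt0Pr => e e0; rewrite -EFinD; apply: BL_inf_le; first by rewrite addr_ge0 // ltW.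
  apply: (@close_at_infinity b); first by rewrite ltrDl.
  by apply/(BL_sup_le n1 n2 b0); rewrite bE.
rewrite leNgt; apply/negP => /ereal_inf_lt[_ [A infA <-]] supA.
have [x Ax] := at_infinity_nonempty y0 infA.
set S := ereal_sup _ in supA.
have S0 : (0 <= S)%E.
  apply: le_trans (BL_pt_ge0 (G1 x) (G2 x)) _.
  by apply: ereal_sup_ubound; exists x.
move: supA S0; case SE : S => [s| |] //; rewrite lte_fin lee_fin => sb s0.
have clos : at_infinity g p [set x | close_forms s (G1 x) (G2 x)].
  have [D DA] := infA; exists D => z /DA Az; apply/BL_pt_le => //.
  by rewrite -SE; apply: ereal_sup_ubound; exists z.
have : (BL_sup h1 h2 <= s%:E)%E by apply/BL_sup_le => //; exact: close_cone.
by rewrite bE lee_fin leNgt sb.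
Qed.

End Comparison.

(** * The isometry *)

Section ComplexResolution.
Context {R : realType} {n : nat} {M N : cmanifold R n.+1}.
Context {C : @cone R (n + n.+1) N}.

Lemma resolution_cone_resolution (pi : resolution M C) :
  @cone_resolution R (n + n.+1) M N C pi (res_inv pi).
Proof.
split.
- exact: res_continuous.
- exact: res_proper.
- exact: res_invK.
- exact: res_mapK.
- move=> y; have [cpsi dpsi] := res_inv_holo pi; split; first exact: cpsi.
  have [s _] := dpsi (chart_at y) (chart_at (res_inv pi y)) (chart_at_atlas _) (chart_at_atlas _).
  apply: differentiable_rV => j; apply: (s j [::]).
  by exists y => //; split; exact: dom_chart_at.
- move=> x y pxy.
  have [s _] := res_map_holo pi (chart_at_atlas x) (chart_at_atlas y).
  apply: differentiable_rV => j; apply: (s j [::]).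
  exists x => //; split; first exact: dom_chart_at.
  by exists y => //; exact: dom_chart_at.
Qed.

(** Otherwise all of M would be the exceptional set, which has dense
    complement. *)
Lemma resolution_cone_inhabited (pi : resolution M C) (p : M) : exists y : N, True.
Proof.
have : closure (pi @^-1` [set~ None]) p by rewrite res_dense.
move=> /(_ setT filterT) [x [/= px _]].
by case pxE : (pi x) px => [y|] // _; exists y.
Qed.

End ComplexResolution.

Section ConicalBall.
Context {R : realType} {n : nat} {N : cmanifold R n.+1}.
Context {C : @cone R (n + n.+1) N} {gC : N -> 'M[R]_(n.+1 + n.+1)} {delta : R}.

Lemma conical_ball_riemannian h : conical_ball C gC delta h -> riemannian h.
Proof. by move=> [[C' [[[]]]]]. Qed.

(** Both metrics are at distance at most delta from gC. *)
Lemma conical_ball_fin_num h k (y : N) : riemannian gC ->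
  conical_ball C gC delta h -> conical_ball C gC delta k ->
  BL_sup h k \is a fin_num.
Proof.
move=> rg Bh Bk; have nh := riemannian_nonneg (conical_ball_riemannian Bh).
have nk := riemannian_nonneg (conical_ball_riemannian Bk).
have ng := riemannian_nonneg rg.
have [_ _ gh] := Bh; have [_ _ gk] := Bk.
rewrite ge0_fin_numE ?BL_sup_ge0 //.
apply: (@le_lt_trans _ _ (delta%:E + delta%:E)%E); last by rewrite -EFinD ltry.
apply: le_trans (BL_sup_triangle y nh ng nk) _.
by rewrite (BL_sup_sym nh ng) leeD.
Qed.

End ConicalBall.

Theorem lemma1p6 (R : realType) (n : nat) (M N : cmanifold R n.+1) (p : M)
    (g : M -> 'M[R]_(n.+1 + n.+1)) (X : M -> 'rV[R]_(n.+1 + n.+1))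
    (C : @cone R (n + n.+1) N) (gC : N -> 'M[R]_(n.+1 + n.+1))
    (pi : resolution M C) (Phi : R -> M -> M) :
  connected [set: M] ->
  ac_expander p g X ->
  kaehler_cone C gC ->
  asymptotic_to_cone pi g X gC ->
  expander_flow X Phi ->
  forall (delta : R)
    (rho : (N -> 'M[R]_(n.+1 + n.+1)) -> (M -> 'M[R]_(n.+1 + n.+1))),
  0 < delta ->
  (forall h, conical_ball C gC delta h ->
     unique (expands_from pi X Phi h) (rho h)) ->
  is_metric (rho @` conical_ball C gC delta) (BL_inf g p) /\
  is_isometry (conical_ball C gC delta) BL_sup
              (rho @` conical_ball C gC delta) (BL_inf g p) rho.
Proof.
move=> cM acg [kgC gCE] [X_radial asym] flow delta rho _ rhoP.
have rs := resolution_cone_resolution pi.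
have [y0 _] := resolution_cone_inhabited pi p.
have rg : riemannian g by case: acg => [[[[]]]].
have rgC : riemannian gC by case: kgC.
have [A [r0 HA]] := asym 0%N.
have [sgC pgC] : (forall y, (gC y)^T = gC y) /\ (forall y, pos_form (gC y)).
  by case: rgC.
have [r1 r1_ge0 dr_bound] := @asymptotic_dr_bound R (n + n.+1) N C
  (res_push pi g) gC A r0 gCE sgC pgC HA.
have eqBL h k : conical_ball C gC delta h -> conical_ball C gC delta k ->
    BL_inf g p (rho h) (rho k) = BL_sup h k.
  move=> Bh Bk; have [[[[kh _ _] _] _ ch] _] := rhoP h Bh.
  have [[[[kk _ _] _] _ ck] _] := rhoP k Bk.
  have [rh _ _] := kh; have [rk _ _] := kk.
  exact: (@BL_inf_eq R (n + n.+1) M N C pi (res_inv pi) rs X Phi X_radial flow g rg cM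
    r1 r1_ge0 dr_bound p (rho h) (rho k) h k rh rk
    (conical_ball_riemannian Bh) (conical_ball_riemannian Bk) ch ck y0
    (conical_ball_fin_num y0 rgC Bh Bk)).
have nonneg h : conical_ball C gC delta h -> nonneg_tensor h.
  by move=> Bh; exact/riemannian_nonneg/(conical_ball_riemannian Bh).
have sym h : conical_ball C gC delta h -> forall x, (h x)^T = h x.
  by move=> Bh; have [] := conical_ball_riemannian Bh.
have sup0 h k : conical_ball C gC delta h -> conical_ball C gC delta k ->
    (BL_sup h k <= 0)%E -> h = k.
  by move=> Bh Bk; apply: BL_sup_eq0; [exact: nonneg|exact: nonneg|exact: sym|exact: sym].
have refl h : conical_ball C gC delta h -> BL_sup h h = 0%E.
  by move=> Bh; apply: (BL_sup_refl y0); exact: nonneg.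
split; last first.
  split; last exact: eqBL.
  split; [by move=> h Bh; exists h| |by []].
  move=> h k /set_mem Bh /set_mem Bk hk; apply: sup0 => //.
  by rewrite -(eqBL _ _ Bh Bk) hk (eqBL _ _ Bk Bk) refl.
split.
- move=> _ _ [h Bh <-] [k Bk <-]; rewrite eqBL //.
  by split; [exact: conical_ball_fin_num y0 rgC Bh Bk|exact: BL_sup_ge0 y0].
- move=> _ _ [h Bh <-] [k Bk <-]; split=> [|hk].
    by rewrite eqBL // => hk; congr rho; apply: sup0; rewrite // hk.
  by rewrite -hk eqBL // refl.
- move=> _ _ [h Bh <-] [k Bk <-]; rewrite !eqBL //.
  by apply: BL_sup_sym; exact: nonneg.
- move=> _ _ _ [h Bh <-] [k Bk <-] [l Bl <-]; rewrite !eqBL //.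
  by apply: (BL_sup_triangle y0); exact: nonneg.
Qed.
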